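(* The following equalities hold: (i) $h_\epsilon(y_0)=k^*(\epsilon,y_0)$ for every $y_0\in Y$ and every $\epsilon\in(0,1)$; (ii) $\lim_{\epsilon\to0}\min_{y_0\in Y}h_\epsilon(y_0)=k^*$; (iii) $\lim_{T\to\infty}\min_{y_0\in Y}v_T(y_0)=k^*$.
   Context: Model. $Y\subset\mathbb R^n$ is a nonempty compact set, $\hat U$ is a compact metric space, $S$ is a Polish space. The function $f:Y\times\hat U\times S\to\mathbb R^n$ is bounded, continuous in $(y,u)$ on $Y\times\hat U$ and Borel measurable in $s$ on $S$. The $S$-valued random elements $s(0),s(1),\dots$ are independent and identically distributed on a common probability space; $s$ denotes a generic random element with the same distribution, and $E[\varphi(f(y,u,s))]$ is the expectation over $s$ with $(y,u)$ fixed. $U(\cdot)$ is an upper semicontinuous multivalued map from $Y$ to nonempty compact subsets of $\hat U$, and $f(y,u,s)\in Y$ for all $y\in Y$, $u\in U(y)$, $s\in S$. $G:=\{(y,u): y\in Y,\ u\in U(y)\}$ (a compact set). $\Pi$ is the set of control plans $\pi=\{\pi_t(\cdot)\}_{t=0,1,\dots}$, where each $\pi_t:Y\to\hat U$ is Borel measurable with $\pi_t(y)\in U(y)$ for all $y\in Y$. For $\pi\in\Pi$ and $y_0\in Y$, the state-control trajectory $(y^{\pi,y_0}(\cdot),u^{\pi,y_0}(\cdot))$ is defined by $y(0)=y_0$, $u(t)=\pi_t(y(t))$, $y(t+1)=f(y(t),u(t),s(t))$. The function $k:Y\times\hat U\to\mathbb R$ is continuous (hence bounded). Optimal values. For $T=1,2,\dots$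 and $\epsilon\in(0,1)$, $$v_T(y_0):=\frac1T\min_{\pi\in\Pi}E\Big[\sum_{t=0}^{T-1}k(y^{\pi,y_0}(t),u^{\pi,y_0}(t))\Big],\qquad h_\epsilon(y_0):=\epsilon\min_{\pi\in\Pi}E\Big[\sum_{t=0}^{\infty}(1-\epsilon)^t k(y^{\pi,y_0}(t),u^{\pi,y_0}(t))\Big]$$ (under these assumptions the minima are attained and $v_T$, $h_\epsilon$ are lower semicontinuous in $y_0$). With $\mathcal P(G)$ the Borel probability measures on $G$ and $C(Y)$ the continuous functions on $Y$, $$W(\epsilon,y_0):=\Big\{\gamma\in\mathcal P(G):\int_G\big((1-\epsilon)(E[\varphi(f(y,u,s))]-\varphi(y))+\epsilon(\varphi(y_0)-\varphi(y))\big)\gamma(dy,du)=0\ \forall\varphi\in C(Y)\Big\},$$ $$W:=\Big\{\gamma\in\mathcal P(G):\int_G\big(E[\varphi(f(y,u,s))]-\varphi(y)\big)\gamma(dy,du)=0\ \forall\varphi\in C(Y)\Big\},$$ $$k^*(\epsilon,y_0):=\min_{\gamma\in W(\epsilon,y_0)}\int_Gk(y,u)\gamma(dy,du),\qquad k^*:=\min_{\gamma\in W}\int_Gk(y,u)\gamma(dy,du).$$ *)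

(* Defs.v *)
From HB Require Import structures.
From mathcomp Require Import all_boot all_order all_algebra finmap.
From mathcomp Require Import all_classical all_reals all_analysis.

Set Implicit Arguments.
Unset Strict Implicit.
Unset Printing Implicit Defensive.

Import Order.TTheory GRing.Theory Num.Theory.
Import numFieldNormedType.Exports.

Local Open Scope classical_set_scope.
Local Open Scope ring_scope.

(* Measurable types are pointed, so a space carrying its Borel sigma-algebra
   has to come with a point. *)
#[short(type="pmetricType")]
HB.structure Definition PointedMetric (K : numDomainType) :=
  {M of Pointed M & Metric K M}.

Notation borel T := (g_sigma_algebraType (@open T)).

Definition borel_fun (T1 T2 : ptopologicalType) (D : set T1) (f : T1 -> T2) :=
  @measurable_fun _ _ (borel T1) (borel T2) D f.

Definition polish (R : realType) (T : topologicalType) : Prop :=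
  exists dist : T -> T -> R,
    [/\ (forall x y, 0 <= dist x y) /\ (forall x y, dist x y = 0 <-> x = y),
        (forall x y, dist x y = dist y x) /\
          (forall x y z, dist x z <= dist x y + dist y z),
        (forall x (A : set T), nbhs x A <->
          exists2 e : R, 0 < e & [set y | dist x y < e] `<=` A),
        (forall u : nat -> T,
          (forall e : R, 0 < e -> exists N : nat, forall i j : nat,
            (N <= i)%N -> (N <= j)%N -> dist (u i) (u j) < e) ->
          exists l : T, u @ \oo --> l) &
        (exists2 D : set T, countable D & dense D)].

Definition upper_semicontinuous_on (T1 T2 : topologicalType)
    (D : set T1) (F : T1 -> set T2) : Prop :=
  forall x, D x -> forall V : set T2, open V -> F x `<=` V ->
    \forall x' \near within D (nbhs x), F x' `<=` V.

Definition iid (R : realType) (d : measure_display) (Omega : measurableType d)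
    (P : probability Omega R) (S : ptopologicalType)
    (s : nat -> Omega -> S) : Prop :=
  [/\ (forall t, @measurable_fun _ _ Omega (borel S) setT (s t)),
      (forall t (B : set (borel S)), measurable B ->
        P (s t @^-1` B) = P (s 0%N @^-1` B)) &
      (forall (I : {fset nat}) (B : nat -> set (borel S)),
        (forall t, measurable (B t)) ->
        P (\bigcap_(t in [set` I]) (s t @^-1` B t)) =
        (\prod_(t <- I) P (s t @^-1` B t))%E)].

(* The least element of A; the value 0 is junk, taken when A has none. *)
Definition minimum (R : realType) (A : set R) : R :=
  xget 0 [set m | A m /\ lbound A m].

Lemma minimumE (R : realType) (A : set R) (m : R) :
  A m -> lbound A m -> minimum A = m.
Proof.
move=> Am lbm; apply: xget_unique => [//|m' [Am' lbm']].
by apply/eqP; rewrite eq_le lbm// lbm'.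
Qed.

Section control_system.
Context (R : realType) (n : nat) (Uh : pmetricType R) (S : ptopologicalType).
Context (d : measure_display) (Omega : measurableType d)
  (P : probability Omega R) (s : nat -> Omega -> S).
Context (Y : set 'rV[R]_n) (U : 'rV[R]_n -> set Uh)
  (f : 'rV[R]_n -> Uh -> S -> 'rV[R]_n) (k : 'rV[R]_n -> Uh -> R).

Definition Ex (X : Omega -> R) : R := fine 'E_P[X]%E.

Definition graph : set ('rV[R]_n * Uh) := [set p | Y p.1 /\ U p.1 p.2].

(* Only the values of a plan on Y matter. *)
Definition plans : set (nat -> 'rV[R]_n -> Uh) :=
  [set pi | forall t, borel_fun Y (pi t) /\ forall y, Y y -> U y (pi t y)].

Fixpoint state (pi : nat -> 'rV[R]_n -> Uh) (y0 : 'rV[R]_n) (t : nat)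
    (w : Omega) : 'rV[R]_n :=
  if t is t'.+1 then
    f (state pi y0 t' w) (pi t' (state pi y0 t' w)) (s t' w)
  else y0.

Definition control (pi : nat -> 'rV[R]_n -> Uh) (y0 : 'rV[R]_n) (t : nat)
    (w : Omega) : Uh :=
  pi t (state pi y0 t w).

Definition v (T : nat) (y0 : 'rV[R]_n) : R :=
  T%:R^-1 * minimum [set
    Ex (fun w => \sum_(0 <= t < T) k (state pi y0 t w) (control pi y0 t w))
    | pi in plans].

Definition h (eps : R) (y0 : 'rV[R]_n) : R :=
  eps * minimum [set
    Ex (fun w => limn (series (fun t =>
      (1 - eps) ^+ t * k (state pi y0 t w) (control pi y0 t w))))
    | pi in plans].

(* E[phi(f(y,u,s))]; s 0 serves as the generic random element s. *)
Definition Enext (phi : 'rV[R]_n -> R) (y : 'rV[R]_n) (u : Uh) : R :=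
  Ex (fun w => phi (f y u (s 0%N w))).

(* A Borel probability measure on the compact set G is encoded as one on the
   whole product space, for its product topology, that gives G mass 1. *)
Definition W_disc (eps : R) (y0 : 'rV[R]_n) :
    set (probability (borel ('rV[R]_n * Uh)%type) R) :=
  [set gamma : probability (borel ('rV[R]_n * Uh)%type) R |
    gamma graph = 1%E /\
    forall phi : 'rV[R]_n -> R, {within Y, continuous phi} ->
      \int[gamma]_(p in graph)
        ((1 - eps) * (Enext phi p.1 p.2 - phi p.1)
         + eps * (phi y0 - phi p.1)) = 0].

Definition W_lim : set (probability (borel ('rV[R]_n * Uh)%type) R) :=
  [set gamma : probability (borel ('rV[R]_n * Uh)%type) R |
    gamma graph = 1%E /\
    forall phi : 'rV[R]_n -> R, {within Y, continuous phi} ->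
      \int[gamma]_(p in graph) (Enext phi p.1 p.2 - phi p.1) = 0].

Definition kstar_disc (eps : R) (y0 : 'rV[R]_n) : R :=
  minimum [set \int[gamma]_(p in graph) k p.1 p.2 | gamma in W_disc eps y0].

Definition kstar : R :=
  minimum [set \int[gamma]_(p in graph) k p.1 p.2 | gamma in W_lim].

End control_system.

(* Main.v *)
(* Proof idea. Call W(0) = W. Testing gamma in W(eps, y0) against continuous phi
   extends to bounded lower semicontinuous V, because V is a pointwise limit of
   continuous functions (Moreau-Yosida regularization).

   Discounted problem. The Bellman equation
   V(y) = min over u in U(y) of eps k(y,u) + (1 - eps) E[V(f(y,u,s))] has a lower
   semicontinuous solution with a Borel minimizing selector. Integrating it
   against gamma in W(eps, y0) gives V(y0) <= int k dgamma. The discounted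
   occupation measure of any plan lies in W(eps, y0), since f(y(t), u(t), s(t))
   only involves noise independent of (y(t), u(t)), and its k-integral is the
   normalized cost of the plan; for the selector equality holds. So the value
   and the minimum over W(eps, y0) are both V(y0), and both are attained.

   Limits. Integrating the Bellman equation, discounted or of finite horizon,
   against gamma in W shows min h_eps <= int k dgamma and min v_T <= int k dgamma.
   Conversely these minima are k-integrals of occupation measures that satisfy
   the constraints of W up to O(eps), resp. O(1/T); by weak compactness of the
   probabilities on G their limit points lie in W. *)

From HB Require Import structures.
Require Import Defs.
From mathcomp Require Import all_boot all_order all_algebra finmap.
From mathcomp Require Import all_classical all_reals all_analysis.
From mathcomp Require Import measurable_realfun ring lra.

Set Implicit Arguments.
Unset Strict Implicit.
Unset Printing Implicit Defensive.

Import Order.TTheory GRing.Theory Num.Theory.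
Import numFieldNormedType.Exports.

Local Open Scope classical_set_scope.
Local Open Scope ring_scope.

(* Joins that the library leaves undeclared; they let the product of the state
   and control spaces be a pointed topological and pseudometric space. *)
HB.instance Definition _ (T U : ptopologicalType) := Pointed.on (T * U)%type.
HB.instance Definition _ (R : numFieldType) (T U : pseudoPMetricType R) := Pointed.on (T * U)%type.
HB.instance Definition _ (R : realType) m n := Pointed.on (matrix R m n).

(** The obstacle is that [f] is regular in one variable at a time: continuous in (y, u) for fixed
    noise, Borel in the noise for fixed (y, u). Adaptedness of the trajectory and the Markov
    property are therefore proved together, by rounding (y(t), u(t)) to finitely many points of the
    compact graph, where independence applies to one point at a time, and passing to the limit by
    continuity. Duality rests on one slack function, [gap], the excess of the objective over the
    value in the Bellman equation. It is nonnegative on the graph; its integral measures how far a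
    measure or a plan is from optimal, and it vanishes along the selector. As [minimum] has a
    default value, each identity between values has to exhibit a minimizer. The limits in [eps] and
    [T] are one statement about filters. It is tested on ultrafilters, along which bounded
    quantities converge without extraction of subsequences. Integrals are compared there, as for
    independence, through the measures of superlevel sets. *)

Lemma cvg_ler_near (R : realType) (I : Type) (F : set_system I)
    {PF : ProperFilter F} (f g : I -> R) (l l' : R) :
  f @ F --> l -> g @ F --> l' -> (\forall i \near F, f i <= g i) -> l <= l'.
Proof.
move=> fl gl fg; rewrite -subr_ge0.
apply: (@closed_cvg I R F PF (fun i => g i - f i) (fun t => 0 <= t)).
- exact: closed_ge.
- by apply: filterS fg => i; rewrite subr_ge0.
- exact: cvgB.
Qed.

(** * Bounded measurable functions and their integrals *)

Section bounded_measurable.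
Context d (T : measurableType d) (R : realType).
Implicit Types (D : set T) (g : T -> R) (mu : {finite_measure set T -> \bar R}).

Definition bmf D g :=
  measurable_fun D g /\ exists M : R, forall x, D x -> `|g x| <= M.

Lemma bmf_integrable D g mu : measurable D -> bmf D g ->
  mu.-integrable D (EFin \o g).
Proof.
move=> mD [mg [M gM]]; apply: measurable_bounded_integrable => //.
  by rewrite ltey_eq fin_num_measure.
by exists M; split; [exact: num_real|move=> x Mx y /gM /le_trans; apply; exact: ltW].
Qed.

Lemma bmf_cst D c : bmf D (fun=> c).
Proof. by split; [exact: measurable_cst|exists `|c|]. Qed.

Lemma bmfD D g1 g2 : bmf D g1 -> bmf D g2 -> bmf D (fun x => g1 x + g2 x).
Proof.
move=> [m1 [M1 h1]] [m2 [M2 h2]]; split; first exact: measurable_funD.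
exists (M1 + M2) => x Dx; apply: le_trans (ler_normD _ _) _.
by rewrite lerD ?h1 ?h2.
Qed.

Lemma bmfZ D c g : bmf D g -> bmf D (fun x => c * g x).
Proof.
move=> [m1 [M1 h1]]; split; first by apply: measurable_funM.
by exists (`|c| * M1) => x Dx; rewrite normrM ler_wpM2l// h1.
Qed.

Lemma bmfB D g1 g2 : bmf D g1 -> bmf D g2 -> bmf D (fun x => g1 x - g2 x).
Proof.
move=> b1 /(bmfZ (-1)) b2; have := bmfD b1 b2.
by under eq_fun do rewrite mulN1r.
Qed.

Lemma eq_bmf D g1 g2 : {in D, g1 =1 g2} -> bmf D g1 -> bmf D g2.
Proof.
move=> e [m [M h]]; split; first by apply: eq_measurable_fun m.
by exists M => x Dx; rewrite -e ?inE// h.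
Qed.

Lemma bmfU D1 D2 g : measurable D1 -> measurable D2 -> bmf D1 g -> bmf D2 g ->
  bmf (D1 `|` D2) g.
Proof.
move=> mD1 mD2 [m1 [M1 h1]] [m2 [M2 h2]]; split; first exact/measurable_funU.
exists (Num.max M1 M2) => x [/h1|/h2] h; rewrite le_max h ?orbT//.
Qed.

Lemma bmfS D1 D2 g : measurable D2 -> D1 `<=` D2 -> bmf D2 g -> bmf D1 g.
Proof.
move=> mD2 D12 [m2 [M2 h2]]; split; first exact: measurable_funS m2.
by exists M2 => x /D12; exact: h2.
Qed.

Lemma Rintegral_norm_le mu D g M : measurable D -> mu D = 1%E -> bmf D g ->
  (forall x, D x -> `|g x| <= M) -> `|\int[mu]_(x in D) g x| <= M.
Proof.
move=> mD muD bg gM; have [mg _] := bg.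
apply: le_trans (le_normr_Rintegral mD (bmf_integrable mu mD bg)) _.
rewrite [leRHS](_ : _ = \int[mu]_(_ in D) M); last first.
  by rewrite Rintegral_cst// (congr1 fine muD) mulr1.
apply: le_Rintegral => //.
- apply: (bmf_integrable (g := fun x => `|g x|)) => //.
  by split; [exact: measurableT_comp|exists M => x Dx; rewrite normr_id gM].
- by apply: (bmf_integrable (g := fun=> M)) => //; exact: bmf_cst.
Qed.

Lemma bmf_sum mu D (c : nat -> R) (g : nat -> T -> R) N : measurable D ->
  (forall t, bmf D (g t)) ->
  bmf D (fun x => \sum_(0 <= t < N) (c t * g t x)) /\
  \int[mu]_(x in D) (\sum_(0 <= t < N) (c t * g t x)) =
  \sum_(0 <= t < N) (c t * \int[mu]_(x in D) g t x).
Proof.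
move=> mD bg; elim: N => [|N [ih1 ih2]].
  split; first by under eq_fun do rewrite big_geq//; exact: bmf_cst.
  under eq_Rintegral do rewrite big_geq//.
  by rewrite big_geq// Rintegral_cst// mul0r.
split.
  under eq_fun do rewrite big_nat_recr//=.
  by apply: bmfD => //; exact: bmfZ.
under eq_Rintegral do rewrite big_nat_recr//=.
rewrite big_nat_recr//= -ih2 RintegralD//.
- by rewrite RintegralZl//; exact: bmf_integrable.
- exact: bmf_integrable.
- by apply: bmf_integrable => //; exact: bmfZ.
Qed.

(** Dominated convergence with a constant bound. Regularity of the limit belongs to the conclusion,
    so that later uses only check the approximants. *)
Lemma bounded_cvg mu D (g_ : (T -> R)^nat) g M : measurable D ->
    (forall n, measurable_fun D (g_ n)) ->
    (forall n x, D x -> `|g_ n x| <= M) ->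
    (forall x, D x -> g_ n x @[n --> \oo] --> g x) ->
  bmf D g /\ \int[mu]_(x in D) g_ n x @[n --> \oo] --> \int[mu]_(x in D) g x.
Proof.
move=> mD mg gM gg.
have bg : bmf D g.
  split; first exact: (measurable_fun_cvg mg gg).
  exists M => x Dx.
  apply: cvg_ler_near (cvg_norm (gg x Dx)) (cvg_cst M) _.
  by apply: nearW => n; exact: gM.
split=> //; apply: fine_cvg; rewrite fineK; last first.
  exact/integrable_fin_num/bmf_integrable.
apply: (@dominated_cvg _ _ _ mu D mD _ _ (cst M%:E)) => //.
- by move=> n; apply/measurable_EFinP.
- by move=> x Dx; apply: cvg_EFin; [exact: nearW|exact: gg].
- by apply: (bmf_integrable mu mD (bmf_cst D M)).
Qed.

End bounded_measurable.

(** * Lower semicontinuity *)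

Lemma closed_borel (X : ptopologicalType) (F : set X) :
  closed F -> measurable (F : set (borel X)).
Proof.
move=> cF; rewrite -[F]setCK; apply: measurableC; apply: sub_sigma_algebra.
exact/closed_openC.
Qed.

Section semicontinuity.
Context {R : realType}.

(* Sublevel sets are required to be closed in the whole space, which encodes
   lower semicontinuity on D only for closed D. *)
Definition lsc_on (X : topologicalType) (D : set X) (g : X -> R) :=
  forall c, closed (D `&` [set x | g x <= c]).

Definition bounded_on (X : Type) (D : set X) (g : X -> R) :=
  exists M : R, forall x, D x -> `|g x| <= M.

(** The sublevel sets of [g] at its own values are closed in the compact [D], and finitely many of
    them share the point of least value; a point common to all of them is a minimizer. *)
Lemma lsc_on_min (X : ptopologicalType) (D : set X) g :
  compact D -> D !=set0 -> lsc_on D g ->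
  exists2 x, D x & forall y, D y -> g x <= g y.
Proof.
move=> cD [x0 Dx0] lg.
have : \bigcap_(y in D) (D `&` [set x | g x <= g y]) !=set0.
  have := cD; rewrite compact_In0; apply.
    exists (fun y => D `&` [set x | g x <= g y]) => //.
    by move=> y Dy; rewrite setIA setIid.
  move=> F FD.
  have [y Dy yF] : exists2 y, D y & forall z, z \in (F : seq X) -> g y <= g z.
    have : forall z, z \in (F : seq X) -> D z by move=> z /FD; rewrite inE.
    elim: (F : seq X) => [|a s ih] sD; first by exists x0.
    have [z zs|y Dy ys] := ih; first by apply: sD; rewrite inE zs orbT.
    have [ay|ay] := leP (g a) (g y); last first.
      exists y => // z; rewrite inE => /predU1P[->|/ys//]; exact: ltW.
    exists a; first by apply: sD; rewrite mem_head.
    by move=> z; rewrite inE => /predU1P[->//|/ys]; apply: le_trans.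
  by exists y => z zF; split=> //=; apply: yF.
by move=> [x xD]; have [Dx _] := xD _ Dx0; exists x => // y /xD [].
Qed.

(** The pointwise supremum is expressed through its upper bounds [c], which is what a sublevel set
    tests: that of [g] is the intersection of those of the [g_ i]. *)
Lemma lsc_on_sup (X : topologicalType) (D : set X) (I : Type) (A : set I) g_ g :
  closed D -> (forall i, A i -> lsc_on D (g_ i)) ->
  (forall x, D x -> forall c, g x <= c <-> forall i, A i -> g_ i x <= c) ->
  lsc_on D g.
Proof.
move=> cD lg gsup c.
rewrite (_ : _ `&` _ = D `&` \bigcap_(i in A) (D `&` [set x | g_ i x <= c])).
  by apply: closedI => //; apply: closed_bigI => i Ai; exact: lg.
apply/seteqP; split=> x [Dx xc]; split=> //=.
  by move=> i Ai; split=> //=; exact: ((gsup x Dx c).1 xc i Ai).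
by apply: (gsup x Dx c).2 => i /xc [].
Qed.

Lemma lsc_on_measurable (X : ptopologicalType) (D : set X) g :
  lsc_on D g -> @measurable_fun _ _ (borel X) R D g.
Proof.
move=> lg mD; apply: (measurability _ (RGenOInfty.measurableE R)) => //.
move=> _ [_ [c ->] <-] /=; rewrite preimage_itvoy.
rewrite (_ : _ `&` _ = D `\` (D `&` [set x | g x <= c])); last first.
  apply/seteqP; split=> x /=; first by rewrite ltNge => -[Dx /negP gc]; split=> // -[].
  by move=> [Dx gc]; split=> //; rewrite ltNge; apply/negP => ?; exact: gc.
by apply: measurableD => //; apply: closed_borel; exact: lg.
Qed.

Lemma lsc_on_bmf (X : ptopologicalType) (D : set X) g :
  lsc_on D g -> bounded_on D g -> bmf (D : set (borel X)) g.
Proof. by move=> /lsc_on_measurable ? ?; split. Qed.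

Lemma within_lsc_on (X : topologicalType) (D : set X) (g : X -> R) :
  closed D -> {within D, continuous g} -> lsc_on D g.
Proof.
move=> cD cg c.
have /closed_subspaceP[V cV e] := (continuous_closedP _).1 cg _ (@closed_le _ c).
by rewrite setIC -[X in X `&` _]/(g @^-1` [set t | t <= c]) -e; exact: closedI.
Qed.

Lemma within_lsc_onN (X : topologicalType) (D : set X) (g : X -> R) :
  closed D -> {within D, continuous g} -> lsc_on D (fun x => - g x).
Proof.
move=> cD cg; apply: within_lsc_on => // x; apply: continuousN; exact: cg.
Qed.

Lemma within_bounded_on (X : ptopologicalType) (D : set X) (g : X -> R) :
  compact D -> closed D -> {within D, continuous g} -> bounded_on D g.
Proof.
move=> kD cD cg; have [D0|/set0P D0] := eqVneq D set0.
  by exists 0 => x; rewrite D0.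
have [a Da ga] := lsc_on_min kD D0 (within_lsc_on cD cg).
have [b Db gb] := lsc_on_min kD D0 (within_lsc_onN cD cg).
exists (`|g a| + `|g b|) => x Dx; rewrite ler_norml; apply/andP; split.
  by have := ga _ Dx; have := ler_norm (- g a); have := normr_ge0 (g b);
     rewrite normrN; lra.
have := gb _ Dx; rewrite lerN2 => /le_trans; apply.
by apply: le_trans (ler_norm _) _; rewrite lerDr.
Qed.

Lemma within_cvg (X Z : topologicalType) (D : set X) (g : X -> Z) (I : Type)
    (F : set_system I) (x_ : I -> X) x :
  Filter F -> {within D, continuous g} -> D x -> (forall i, D (x_ i)) ->
  x_ @ F --> x -> g \o x_ @ F --> g x.
Proof.
move=> FF cg Dx Dx_ xx A Ax.
have : nbhs (x : subspace D) (g @^-1` A) := cg x _ Ax.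
rewrite nbhs_simpl /= /nbhs/= -nbhs_subspace_in// => /xx.
by rewrite nbhs_simpl/=; apply: filterS => i; apply.
Qed.

End semicontinuity.

Lemma norm_sub_continuous {R : realType} (V : normedModType R) (x : V) :
  continuous (fun y => `|x - y|).
Proof.
by move=> y; apply: cvg_norm; apply: cvgB; [exact: cvg_cst|exact: cvg_id].
Qed.

(** * Approximation of lower semicontinuous functions from below *)

Section moreau_yosida.
Context {R : realType} (V : normedModType R) (Y : set V) (g : V -> R) (M : R).
Context (Y0 : Y !=set0) (lg : lsc_on Y g)
  (gM : forall y, Y y -> `|g y| <= M).

Let A j y := [set g z + j%:R * `|y - z| | z in Y].
(** Infimal convolution of [g], on [Y], with [j] times the norm. It inherits the Lipschitz constant
    [j] of the penalty, and a growing penalty forces near-minimizers towards [y]. *)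
Let psi (j : nat) y := inf (A j y).

Let lbA j y : lbound (A j y) (- M).
Proof.
move=> _ [z Yz <-]; have := gM Yz; rewrite ler_norml => /andP[h _].
by apply: le_trans h _; rewrite lerDl mulr_ge0.
Qed.

Let infA j y : has_inf (A j y).
Proof.
split; last by exists (- M); exact: lbA.
by have [z Yz] := Y0; exists (g z + j%:R * `|y - z|), z.
Qed.

Let psi_le j y z : Y z -> psi j y <= g z + j%:R * `|y - z|.
Proof. by move=> Yz; apply: ge_inf; [exact: (infA j y).2|exists z]. Qed.

Let psi_ge j y c : (forall z, Y z -> c <= g z + j%:R * `|y - z|) -> c <= psi j y.
Proof.
by move=> h; apply: lb_le_inf; [exact: (infA j y).1|move=> _ [z Yz <-]; exact: h].
Qed.

Let psi_le_g j y : Y y -> psi j y <= g y.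
Proof. by move=> Yy; have := psi_le j y Yy; rewrite subrr normr0 mulr0 addr0. Qed.

Let psi_lip j y y' : psi j y <= psi j y' + j%:R * `|y - y'|.
Proof.
rewrite -lerBlDr; apply: psi_ge => z Yz; rewrite lerBlDr.
apply: le_trans (psi_le j y Yz) _; rewrite -addrA lerD2l -mulrDr ler_wpM2l//.
by rewrite [leRHS]addrC; exact: ler_distD.
Qed.

Let psi_cont j : continuous (psi j).
Proof.
move=> y; apply/cvgrPdist_le => e e0; near=> y'.
have h : j%:R * `|y - y'| <= e.
  (* The denominator is [j.+1] rather than [j] to cover [j = 0]. *)
  have /ltW : `|y - y'| < e / j.+1%:R.
    by near: y'; apply: cvgr_dist_lt => //; rewrite divr_gt0.
  rewrite ler_pdivlMr// mulrC; apply: le_trans.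
  by rewrite ler_wpM2r// ler_nat.
rewrite ler_distl; have := psi_lip j y y'; have := psi_lip j y' y.
by rewrite distrC; move: h; lra.
Unshelve. all: by end_near. Qed.

Let psi_cvg y : Y y -> psi j y @[j --> \oo] --> g y.
Proof.
move=> Yy; apply/cvgrPdist_le => e e0.
have : nbhs y (~` (Y `&` [set x | g x <= g y - e])).
  apply: open_nbhs_nbhs; split; first exact/closed_openC/lg.
  by move=> [_ /=]; rewrite leNgt ltrBlDr ltrDl e0.
rewrite -nbhs_ballE => -[r /= r0 yr]; near=> j.
(* Values of [g] differ by at most [2 * M], so once [j * r] reaches this no point at distance [r] or
   more brings the infimum below [g y]. Closer points are handled by lower semicontinuity. *)
have Mj : 2 * M / r <= j%:R by near: j; exact: nbhs_infty_ger.
rewrite ger0_norm ?subr_ge0 ?psi_le_g// lerBlDr -lerBlDl.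
apply: psi_ge => z Yz.
have := gM Yz; have := gM Yy; rewrite !ler_norml => /andP[_ yM] /andP[zM _].
have [yz|yz] := ltP `|y - z| r.
  have : ~ g z <= g y - e.
    by move=> gz; apply: (yr z); [rewrite -ball_normE|split].
  move=> /negP; rewrite -ltNge => /ltW h; apply: le_trans h _.
  by rewrite lerDl mulr_ge0.
have : 2 * M <= j%:R * `|y - z|.
  move: Mj; rewrite ler_pdivrMr// => h; apply: le_trans h _.
  by rewrite ler_wpM2l.
lra.
Unshelve. all: by end_near. Qed.

Lemma lsc_approx : exists psi_ : nat -> V -> R,
  [/\ forall j, continuous (psi_ j), forall j y, Y y -> `|psi_ j y| <= M,
      forall j y, Y y -> psi_ j y <= g y &
      forall y, Y y -> psi_ j y @[j --> \oo] --> g y].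
Proof.
exists psi; split => // j y Yy; rewrite ler_norml; apply/andP; split.
  by apply: psi_ge => z Yz; apply: (lbA (j := j) (y := y)); exists z.
apply: le_trans (psi_le_g j Yy) _.
by have := gM Yy; rewrite ler_norml => /andP[].
Qed.

End moreau_yosida.

(** * Weak compactness of the probabilities on a compact set *)

Lemma ultra_cvg_compact (T : topologicalType) (I : Type) (w : set_system I)
    (u : I -> T) (A : set T) :
  UltraFilter w -> compact A -> (forall i, A (u i)) -> exists2 l, A l & u @ w --> l.
Proof.
move=> uw cA uA; have pw : ProperFilter w by exact: ultra_proper.
have [l [Al cl]] := cA (u @ w) (fmap_proper_filter u pw) (nearW _ uA).
exists l => // B Bl.
have [//|wB] := in_ultra_setVsetC (u @^-1` B) uw.
by have [y [nBy By]] := cl (~` B) B wB Bl.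
Qed.

Section weak_limit.
Context {R : realType} (X : pseudoPMetricType R) (K : set X).
Context (I : Type) (w : set_system I) {uw : UltraFilter w}.
Context (gam : I -> probability (borel X) R).
Context (cK : closed K) (kK : compact K) (gamK : forall i, gam i K = 1%E).

Let mopen (F : set X) : open F -> measurable (F : set (borel X)).
Proof. exact: sub_sigma_algebra. Qed.

Let pw : ProperFilter w. Proof. exact: ultra_proper. Qed.

(* The ultralimit of the gam i is only finitely additive; its inner
   regularization on open sets generates an outer measure for which open sets
   are Caratheodory measurable, whence a Borel probability. *)
Definition ultra_content (A : set (borel X)) : R :=
  lim (fine (gam i A) @[i --> w]).
Local Notation m := ultra_content.

Let gam01 i A : measurable A -> 0 <= fine (gam i A) <= 1.
Proof.
move=> mA; rewrite fine_ge0//= -lee_fin fineK ?fin_num_measure//.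
exact: probability_le1.
Qed.

Lemma ultra_content_cvg A : measurable A -> fine (gam i A) @[i --> w] --> m A.
Proof.
move=> mA; have [l _ ul] : exists2 l : R, `[0, 1]%classic l & fine (gam i A) @[i --> w] --> l.
  apply: (@ultra_cvg_compact R I w (fun i => fine (gam i A)) `[0, 1]%classic); first exact: segment_compact.
  by move=> i /=; rewrite in_itv/=; exact: gam01.
by rewrite /m (cvg_lim _ ul).
Qed.

Let m_le A B : measurable A -> measurable B -> A `<=` B -> m A <= m B.
Proof.
move=> mA mB AB.
apply: cvg_ler_near (ultra_content_cvg mA) (ultra_content_cvg mB) _.
by apply: nearW => i; apply: fine_le; rewrite ?fin_num_measure// le_measure ?inE.
Qed.

Let m0 : m set0 = 0.
Proof.
apply/cvg_lim => //; under eq_fun do rewrite measure0.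
exact: cvg_cst.
Qed.

Let mU A B : measurable A -> measurable B -> A `&` B = set0 ->
  m (A `|` B) = m A + m B.
Proof.
move=> mA mB AB0; apply/cvg_lim => //.
under eq_fun do rewrite measureU// fineD ?fin_num_measure//.
by apply: cvgD; exact: ultra_content_cvg.
Qed.

Let mUle A B : measurable A -> measurable B -> m (A `|` B) <= m A + m B.
Proof.
move=> mA mB; rewrite (_ : A `|` B = A `|` (B `\` A)); last by rewrite setUDr setDv setD0.
rewrite mU//; [|exact: measurableD|by rewrite setDE setICA setICr setI0].
by rewrite lerD2l; apply: m_le => //; exact: measurableD.
Qed.

Let mK : m K = 1.
Proof.
apply/cvg_lim => //; under eq_fun do rewrite gamK/=.
exact: cvg_cst.
Qed.

(** Only closed sets inside the compact [K] compete: they are compact, so countable subadditivity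
    follows from finite subadditivity. *)
Definition inner_content (O : set X) : \bar R :=
  ereal_sup [set (m F)%:E | F in [set F | closed F /\ F `<=` O `&` K]].
Local Notation lam := inner_content.

Let lam_ub F (O : set X) : closed F -> F `<=` O -> F `<=` K -> ((m F)%:E <= lam O)%E.
Proof.
move=> cF FO FK; apply: ereal_sup_ubound; exists F => //; split => //.
by move=> x Fx; split; [exact: FO|exact: FK].
Qed.

Let lam_le (O : set X) c :
  (forall F, closed F -> F `<=` O -> F `<=` K -> ((m F)%:E <= c)%E) -> (lam O <= c)%E.
Proof.
move=> h; apply: ge_ereal_sup => _ [F [cF FO] <-].
by apply: h => // x /FO [].
Qed.

Let lam_ge0 O : (0 <= lam O)%E.
Proof. by have := @lam_ub set0 O closed0 (@sub0set _ _) (@sub0set _ _); rewrite m0. Qed.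

Let lam_mono O1 O2 : O1 `<=` O2 -> (lam O1 <= lam O2)%E.
Proof. by move=> O12; apply: lam_le => F cF FO FK; apply: lam_ub => // x /FO/O12. Qed.

Let lamU O1 O2 : open O1 -> open O2 -> (lam (O1 `|` O2) <= lam O1 + lam O2)%E.
Proof.
move=> oO1 oO2; apply: lam_le => F cF FO FK.
(* Normality separates the disjoint closed parts of [F] outside [O1] and outside [O2]. Removing
   either separating open set from [F] leaves closed pieces, one in [O1] and one in [O2], that
   together cover [F]. *)
have := @pseudometric_normal R X; move/(@normal_openP R).
move=> /(_ (F `\` O1) (F `\` O2)) [].
- by apply: closedI => //; exact: open_closedC.
- by apply: closedI => //; exact: open_closedC.
- by rewrite -subset0 => x [[Fx nO1] [_ nO2]]; have [] := FO _ Fx.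
move=> W1 [W2] [oW1 oW2 FW1 FW2 W12].
have cF1 : closed (F `\` W1) by apply: closedI => //; exact: open_closedC.
have cF2 : closed (F `\` W2) by apply: closedI => //; exact: open_closedC.
have -> : F = (F `\` W1) `|` (F `\` W2).
  apply/seteqP; split => x; last by move=> [[]|[]].
  move=> Fx; have [W1x|] := pselect (W1 x); last by left.
  right; split => // W2x; have : (W1 `&` W2) x by [].
  by rewrite W12.
apply: (@le_trans _ _ (m (F `\` W1) + m (F `\` W2))%:E).
  by rewrite lee_fin mUle//; exact: closed_borel.
rewrite EFinD leeD//; apply: lam_ub => //.
- move=> x [Fx nW1]; apply: contrapT => nO1; apply: nW1; exact: FW1.
- by move=> x [/FK].
- move=> x [Fx nW2]; apply: contrapT => nO2; apply: nW2; exact: FW2.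
- by move=> x [/FK].
Qed.

Let lam0 : lam set0 = 0%E.
Proof.
apply/eqP; rewrite eq_le lam_ge0 andbT; apply: lam_le => F _ F0 _.
by rewrite (_ : F = set0) ?m0// -subset0.
Qed.

Let lam_bigsetU (O : nat -> set X) n : (forall i, open (O i)) ->
  (lam (\big[setU/set0]_(i < n) O i) <= \sum_(i < n) lam (O i))%E.
Proof.
move=> oO; elim: n => [|n ih]; first by rewrite !big_ord0 lam0.
rewrite !big_ord_recr/=; apply: le_trans (lamU _ _) _ => //.
  by rewrite -bigcup_mkord; apply: bigcup_open => i _; exact: oO.
by rewrite leeD2r.
Qed.

Let lam_bigcup (O : nat -> set X) : (forall i, open (O i)) ->
  (lam (\bigcup_i O i) <= \sum_(i <oo) lam (O i))%E.
Proof.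
move=> oO; apply: lam_le => F cF FO FK.
have kF : compact F by exact: subclosed_compact cF kK FK.
move: (kF); rewrite compact_cover => /(_ _ setT O (fun i _ => oO i) FO) [D _ FD].
pose n := (\max_(i <- D) i).+1.
have FU : F `<=` \big[setU/set0]_(i < n) O i.
  move=> x /FD [i /= iD Oix]; rewrite -bigcup_mkord; exists i => //=.
  by rewrite /n ltnS (big_rem i)//= leq_maxl.
apply: le_trans (lam_ub cF FU FK) _.
apply: le_trans (lam_bigsetU n oO) _.
rewrite -(big_mkord xpredT (fun i => lam (O i))).
by apply: nneseries_lim_ge => *; exact: lam_ge0.
Qed.

Definition weak_outer (A : set X) : \bar R :=
  ereal_inf [set lam O | O in [set O | open O /\ A `<=` O]].
Local Notation mu := weak_outer.

Let mu_lb A O : open O -> A `<=` O -> (mu A <= lam O)%E.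
Proof. by move=> oO AO; apply: ereal_inf_lbound; exists O. Qed.

Let mu_ge A c : (forall O, open O -> A `<=` O -> (c <= lam O)%E) -> (c <= mu A)%E.
Proof. by move=> h; apply: le_ereal_inf_tmp => _ [ O [oO AO] <-]; exact: h. Qed.

Let mu_open O : open O -> mu O = lam O.
Proof.
move=> oO; apply/eqP; rewrite eq_le mu_lb//=.
by apply: mu_ge => O' _; exact: lam_mono.
Qed.

Let mu_ge0 A : (0 <= mu A)%E.
Proof. by apply: mu_ge => *; exact: lam_ge0. Qed.

Let mu0 : mu set0 = 0%E.
Proof. by rewrite mu_open ?lam0//; exact: open0. Qed.

Let mu_le : {homo mu : A B / A `<=` B >-> (A <= B)%E}.
Proof.
by move=> A B AB; apply: mu_ge => O oO BO; apply: mu_lb => // x /AB/BO.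
Qed.

Let lam_le1 O : (lam O <= 1)%E.
Proof.
by apply: lam_le => F cF _ FK; rewrite lee_fin -mK; apply: m_le => //; exact: closed_borel.
Qed.

Let mu_fin A : mu A \is a fin_num.
Proof.
rewrite ge0_fin_numE//; apply: le_lt_trans (ltry 1).
by apply: le_trans (lam_le1 setT); exact: (mu_lb openT).
Qed.

Let mu_sub : sigma_subadditive mu.
Proof.
move=> A; apply/lee_addgt0Pr => e e0.
have /choice[ O OP] : forall n, exists O, [/\ open O, A n `<=` O &
    (lam O <= mu (A n) + (e / (2 ^ n.+1)%:R)%:E)%E].
  move=> n; have e2 : 0 < e / (2 ^ n.+1)%:R :> R.
    by rewrite divr_gt0// ltr0n expn_gt0.
  have [_ [ O [oO AO] <-] h] := lb_ereal_inf_adherent e2 (mu_fin (A n)).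
  by exists O; split => //; exact: ltW.
apply: le_trans (epsilon_trick _ _ (ltW e0)) => //.
apply: (@le_trans _ _ (lam (\bigcup_i O i))).
  apply: mu_lb; first by apply: bigcup_open => i _; have [] := OP i.
  by apply: subset_bigcup => i _; have [] := OP i.
apply: le_trans (lam_bigcup _) _; first by move=> i; have [] := OP i.
by apply: lee_nneseries => [i _ _|i _]; [exact: lam_ge0|have [] := OP i].
Qed.

HB.instance Definition _ := isOuterMeasure.Build R X mu mu0 mu_ge0 mu_le mu_sub.

(** Fix an open [U] containing [A]. A closed set in the part of [U] inside [O] and a closed set in
    the rest of [U] are disjoint, so their contents add up to at most [lam U]; suprema, over the
    second set first, bound the two parts of [A]. *)
Let open_cara O : open O -> mu.-caratheodory O.
Proof.
move=> oO; apply: (@le_caratheodory_measurable R X mu) => A.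
apply: mu_ge => U oU AU.
have h1 F : closed F -> F `<=` U `&` O -> F `<=` K ->
    ((m F)%:E + mu (A `&` ~` O) <= lam U)%E.
  move=> cF FUO FK.
  apply: (@le_trans _ _ ((m F)%:E + lam (U `\` F))%E).
    rewrite leeD2l//; apply: mu_lb; first by apply: openI => //; exact/closed_openC.
    by move=> x [Ax nO]; split; [exact: AU|move=> /FUO []].
  rewrite -leeBrDl//; apply: lam_le => F' cF' FU' FK'.
  rewrite leeBrDl// -EFinD -mU; [|exact: closed_borel|exact: closed_borel|].
    apply: lam_ub; first exact: closedU.
      by move=> x [/FUO[]|/FU'[]].
    by move=> x [/FK|/FK'].
  by rewrite -subset0 => x [Fx /FU'[]].
apply: (@le_trans _ _ (lam (U `&` O) + mu (A `&` ~` O))%E).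
  by rewrite leeD2r//; apply: mu_lb; [exact: openI|exact: setSI].
rewrite -leeBrDr ?mu_fin//; apply: lam_le => F cF FUO FK.
by rewrite leeBrDr ?mu_fin// h1.
Qed.

Let borel_cara (A : set (borel X)) : measurable A -> mu.-caratheodory A.
Proof.
have : <<s @open X >> `<=` mu.-cara.-measurable.
  apply: smallest_sub.
    split => //; [by move=> B mB; rewrite setTD; exact: measurableC |
                  by move=> u_ mu_; exact: bigcupT_measurable].
  exact: open_cara.
exact.
Qed.

Definition weak_limit (A : set (borel X)) : \bar R := mu A.

Let weak_limit_additive : semi_sigma_additive weak_limit.
Proof.
move=> F mF tF mUF.
by apply: (@caratheodory_measure_sigma_additive R X mu) => //;
  [move=> i; exact: borel_cara|exact: borel_cara].
Qed.

HB.instance Definition _ := isMeasure.Build _ _ R weak_limit mu0 mu_ge0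
  weak_limit_additive.

Let weak_limit1 : weak_limit setT = 1%E.
Proof.
rewrite /weak_limit mu_open; last exact: openT.
apply/eqP; rewrite eq_le lam_le1/= -mK; exact: lam_ub.
Qed.

HB.instance Definition _ := Measure_isProbability.Build _ _ R weak_limit weak_limit1.

Lemma weak_limit_isprobability :
  exists nu : probability (borel X) R, nu = weak_limit :> (set _ -> \bar R).
Proof. by eexists (weak_limit : probability (borel X) R). Qed.

Lemma weak_limitC : weak_limit (~` K) = 0%E.
Proof.
rewrite /weak_limit mu_open; last exact/closed_openC.
apply/eqP; rewrite eq_le lam_ge0 andbT; apply: lam_le => F _ FnK FK.
rewrite (_ : F = set0) ?m0// -subset0 => x Fx; exact: (FnK _ Fx (FK _ Fx)).
Qed.

Lemma weak_limitK : weak_limit K = 1%E.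
Proof.
have : weak_limit (K `|` ~` K) = (weak_limit K + weak_limit (~` K))%E.
  apply: (measureU weak_limit) (setICr K); first exact: closed_borel.
  by apply: measurableC; exact: closed_borel.
by rewrite setUv weak_limitC adde0 weak_limit1.
Qed.

(** The open-set half of the portmanteau theorem: inner approximation by closed sets can only lose
    mass compared with the ultralimit. *)
Lemma weak_limit_open O : open O -> (weak_limit (K `&` O) <= (m (K `&` O))%:E)%E.
Proof.
move=> oO; apply: (@le_trans _ _ (lam O)).
  by apply: mu_lb => //; exact: subIsetr.
apply: lam_le => F cF FO FK; rewrite lee_fin; apply: m_le; first exact: closed_borel.
  by apply: measurableI; [exact: closed_borel|exact: mopen].
by move=> x Fx; split; [exact: FK|exact: FO].
Qed.


End weak_limit.

(** * Layer-cake sums *)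

Section layer_cake.
Context d (T : measurableType d) {R : realType} (D : set T) (phi : T -> R).
Context (mD : measurable D) (bphi : bmf D phi).
Context (phi0 : forall x, D x -> 0 <= phi x).

Let E (del : R) i := D `&` [set x | del * i.+1%:R < phi x].

(** Lower Riemann sum of mesh [del] for the layer-cake formula, which integrates t -> nu (phi > t).
    It reduces comparisons of integrals to comparisons of measures of sets. *)
Definition layers (nu : probability T R) (del : R) (n : nat) : R :=
  \sum_(i < n) del * fine (nu (E del i)).

Let s del n x : R := \sum_(i < n) del * \1_(E del i) x.

Let mE del i : measurable (E del i).
Proof.
have := bphi.1 mD _ (@measurable_itv R `]del * i.+1%:R, +oo[).
by rewrite preimage_itvoy.
Qed.

(** Where [phi x > 0], [s del n x] is the largest multiple of [del] strictly below [phi x], capped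
    at [del * n]. The minimum in the third bound accounts for the cap and disappears once [n] is
    large. *)
Let s_bound del n x : 0 < del -> D x ->
  [/\ s del n x <= phi x, s del n x <= del * n%:R &
      Num.min (phi x) (del * n.+1%:R) <= s del n x + del].
Proof.
move=> d0 Dx; elim: n => [|n [s1 s2 s3]].
  rewrite /s big_ord0 mulr0 add0r mulr1; split=> //; first exact: phi0.
  by rewrite ge_min lexx orbT.
have -> : s del n.+1 x = s del n x + del * \1_(E del n) x.
  by rewrite /s big_ord_recr.
rewrite indicE; have [h|h] := ltP (del * n.+1%:R) (phi x).
  rewrite mem_set//= mulr1; split.
  - apply: le_trans (ltW h); rewrite -natr1 mulrDr mulr1; lra.
  - by rewrite -natr1 mulrDr mulr1; lra.
  - rewrite ge_min; apply/orP; right; move: s3; rewrite min_r; last exact: ltW.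
    by rewrite -(natr1 n.+1) mulrDr mulr1; lra.
rewrite memNset/=; last by move=> -[_ /=]; rewrite ltNge h.
rewrite mulr0 addr0; split => //.
- by apply: le_trans s2 _; rewrite ler_pM2l// ler_nat.
- by rewrite ge_min; move: s3; rewrite min_l// => ->.
Qed.

Let bs del n : bmf D (s del n).
Proof.
rewrite /s; elim: n => [|n ih].
  by under eq_fun do rewrite big_ord0; exact: bmf_cst.
under eq_fun do rewrite big_ord_recr/=; apply: bmfD => //; apply: bmfZ.
split; first by apply: measurable_indic.
by exists 1 => x _; rewrite indicE; case: (_ \in _); rewrite /= ?normr0 ?normr1.
Qed.

Let int_s (nu : probability T R) del n : \int[nu]_(x in D) s del n x = layers nu del n.
Proof.
rewrite /s /layers; elim: n => [|n ih].
  under eq_Rintegral do rewrite big_ord0.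
  by rewrite big_ord0 Rintegral_cst// mul0r.
under eq_Rintegral do rewrite big_ord_recr/=.
have bi : bmf D (fun x => \1_(E del n) x : R).
  split; first by apply: measurable_indic.
  by exists 1 => x _; rewrite indicE; case: (_ \in _); rewrite /= ?normr0 ?normr1.
rewrite RintegralD//; [|by apply: bmf_integrable => //; exact: bs|
  by apply: bmf_integrable => //; exact: bmfZ].
rewrite ih big_ord_recr/= RintegralZl//; last exact: bmf_integrable.
congr (_ + _ * _); rewrite /Rintegral integral_indic//.
by rewrite setIC setIA setIid.
Qed.

Lemma layers_le (nu : probability T R) del n : 0 < del -> layers nu del n <= \int[nu]_(x in D) phi x.
Proof.
move=> d0; rewrite -int_s; apply: le_Rintegral => //.
- by apply: bmf_integrable => //; exact: bs.
- exact: bmf_integrable.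
- by move=> x Dx; have [] := s_bound n d0 Dx.
Qed.

Lemma layers_ge (nu : probability T R) del n : 0 < del -> (forall x, D x -> phi x <= del * n.+1%:R) ->
  \int[nu]_(x in D) phi x <= layers nu del n + del.
Proof.
move=> d0 phin; apply: (@le_trans _ _ (\int[nu]_(x in D) (s del n x + del))).
  apply: le_Rintegral => //; first exact: bmf_integrable.
    by apply: bmf_integrable => //; apply: bmfD; [exact: bs|exact: bmf_cst].
  by move=> x Dx; have [_ _] := s_bound n d0 Dx; rewrite min_l// phin.
rewrite RintegralD//; [|by apply: bmf_integrable => //; exact: bs|
  by apply: bmf_integrable => //; exact: bmf_cst].
rewrite int_s lerD2l Rintegral_cst// ger_pMr// -lee_fin fineK ?fin_num_measure//.
exact: probability_le1.
Qed.

End layer_cake.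

Section weak_compactness.
Context {R : realType} (X : pseudoPMetricType R) (K : set X).

(** For lower semicontinuous [phi] only an inequality can be expected: its superlevel sets are
    relatively open in [K], and open sets may lose mass in the limit. Layers transfer this from sets
    to [phi]. *)
Theorem weak_compactness (I : Type) (w : set_system I)
    (gam : I -> probability (borel X) R) :
  UltraFilter w -> closed K -> compact K -> (forall i, gam i K = 1%E) ->
  exists mu : probability (borel X) R, mu K = 1%E /\
    forall (phi : X -> R) (l : R), lsc_on K phi -> bounded_on K phi ->
      \int[gam i]_(x in K) phi x @[i --> w] --> l ->
      \int[mu]_(x in K) phi x <= l.
Proof.
move=> uw cK kK gamK.
pose mu := weak_limit K w gam.
have mK : measurable (K : set (borel X)).
  exact: closed_borel.
have [nu nuE] : exists nu : probability (borel X) R, nu = mu :> (set _ -> \bar R).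
  pose H1 := weak_limit_isprobability cK kK gamK; exact: H1.
exists nu; split; first by rewrite nuE; exact: weak_limitK.
move=> phi l lphi [M phiM] phil.
have pw : ProperFilter w by exact: ultra_proper.
pose psi x := phi x + M.
have bphi : bmf (K : set (borel X)) phi by apply: lsc_on_bmf => //; exists M.
have bpsi : bmf (K : set (borel X)) psi by apply: bmfD => //; exact: bmf_cst.
have psi0 x : K x -> 0 <= psi x.
  by move=> /phiM; rewrite ler_norml /psi => /andP[? _]; lra.
have intpsi (P : probability (borel X) R) : P K = 1%E ->
    \int[P]_(x in K) psi x = \int[P]_(x in K) phi x + M.
  move=> PK; rewrite RintegralD//; [|exact: bmf_integrable|
    by apply: bmf_integrable => //; exact: bmf_cst].
  by rewrite Rintegral_cst// (congr1 fine PK) mulr1.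
apply/ler_addgt0Pr => e e0; rewrite -(lerD2r M) -intpsi; last first.
  by rewrite nuE; exact: weak_limitK.
(* After the shift by [M] the values lie between 0 and [2 * M], and [n.+1] layers of height [e]
   reach past this. *)
pose n := Num.truncn (2 * M / e).
have psin x : K x -> psi x <= e * n.+1%:R.
  move=> /phiM; rewrite ler_norml /psi => /andP[_ h].
  have : 2 * M / e < n.+1%:R by exact: truncnS_gt.
  by rewrite ltr_pdivrMr// mulrC; lra.
apply: le_trans (layers_ge mK bpsi psi0 nu e0 psin) _.
rewrite addrAC lerD2r.
pose E i := K `&` [set x | e * i.+1%:R < psi x].
apply: (@le_trans _ _ (\sum_(i < n) e * ultra_content w gam (E i))).
  apply: ler_sum => i _; rewrite ler_pM2l// /E.
  have -> : K `&` [set x | e * i.+1%:R < psi x] =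
            K `&` ~` (K `&` [set x | phi x <= e * i.+1%:R - M]).
    apply/seteqP; split=> x /= [Kx h]; split=> //.
      by move=> [_]; rewrite leNgt ltrBlDr h.
    by rewrite ltNge /psi -lerBrDr; apply/negP => ?; apply: h.
  rewrite -lee_fin fineK ?fin_num_measure//; last first.
    apply: measurableI => //; apply: sub_sigma_algebra.
    exact/closed_openC/lphi.
  by rewrite nuE; apply: weak_limit_open => //; exact/closed_openC/lphi.
have cl : layers (K : set (borel X)) psi (gam i) e n @[i --> w] -->
    (\sum_(i < n) e * ultra_content w gam (E i) : R).
  rewrite /layers; apply: cvg_big => [|i _]; first exact: add_continuous.
  apply: cvgMl_tmp.
  apply: ultra_content_cvg.
  have := bpsi.1 mK _ (@measurable_itv R `]e * i.+1%:R, +oo[).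
  by rewrite preimage_itvoy.
have cr : \int[gam i]_(x in K) psi x @[i --> w] --> l + M.
  under eq_fun do rewrite intpsi//.
  by apply: cvgD => //; exact: cvg_cst.
apply: cvg_ler_near cl cr _.
by apply: nearW => i; exact: layers_le.
Qed.

End weak_compactness.

(** * Measurable selection *)

Lemma compact_subcover (X : ptopologicalType) (K : set X) (N : X -> set X) :
  compact K -> (forall x, K x -> nbhs x (N x)) ->
  exists s : seq X, (forall x, x \in s -> K x) /\
    forall x, K x -> exists2 y, y \in s & N y x.
Proof.
move=> + KN; rewrite compact_cover.
move=> /(_ _ K (fun x => (N x)°)) [].
- by move=> x _; exact: open_interior.
- by move=> x Kx; exists x => //; exact: (nbhs_singleton (nbhs_interior (KN _ Kx))).
move=> D DK KD; exists (enum_fset D); split=> [x xD|x /KD[y /= yD xy]].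
  by have := DK _ xD; rewrite inE.
by exists y => //; exact: interior_subset xy.
Qed.

Lemma closed_mdist_le {R : realType} (X : metricType R) (d : X) (c : R) :
  closed [set u | mdist d u <= c].
Proof.
rewrite -[X in closed X]setCK; apply: open_closedC; rewrite openE => u /= /negP.
rewrite -ltNge => cu; rewrite /interior -nbhs_ballE.
exists (mdist d u - c); first by rewrite /= subr_gt0.
move=> t; rewrite ballEmdist /= => ut; apply/negP; rewrite -ltNge.
have := metric_triangle d t u; rewrite (metric_sym t u); lra.
Qed.

Lemma closed_slice (S T : topologicalType) (C : set (S * T)) (y : S) :
  closed C -> closed [set u | C (y, u)].
Proof.
move=> cC; apply: (@preimage_closed T (S * T)%type (fun u => (y, u)) C) => // u _.
by apply: cvg_pair => /=; [exact: cvg_cst|exact: cvg_id].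
Qed.

Lemma compact_bigcap_nat (X : ptopologicalType) (F : nat -> set X) :
  compact [set: X] -> (forall n, closed (F n)) -> (forall n, F n.+1 `<=` F n) ->
  (forall n, F n !=set0) -> \bigcap_n F n !=set0.
Proof.
move=> kX cF dF F0; have := kX; rewrite compact_In0; apply.
  by exists F => // n _; rewrite setTI.
move=> D _; pose N := (\max_(i <- enum_fset D) i)%N.
have dec m n : (m <= n)%N -> F n `<=` F m.
  move=> /subnK <-; elim: (n - m)%N => [//|k ih] x.
  by rewrite addSn => /dF/ih.
have [x Fx] := F0 N; exists x => n /= nD; apply: dec Fx.
by rewrite /N (big_rem n)//= leq_maxl.
Qed.

Section measurable_selection.
Context {R : realType} (T : ptopologicalType) (Z : pmetricType R).
Context (hT : hausdorff_space T) (kZ : compact [set: Z]).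
Context (G : set (T * Z)) (cG : closed G) (kG : compact G).

(* The selector minimizes the objective first and then, successively, functions
   separating the points of Z: the minimizers shrink to a single point, and each
   step preserves the measurability of the sets of y hitting a closed set. *)
Section iterated_argmin.
Context (g : nat -> T * Z -> R) (lg : forall n, lsc_on G (g n)).

Fixpoint argmins (n : nat) (y : T) : set Z :=
  if n is n'.+1 then
    [set u | argmins n' y u /\ forall u', argmins n' y u' -> g n' (y, u) <= g n' (y, u')]
  else [set u | G (y, u)].

Lemma argmins_sub n y u : argmins n y u -> G (y, u).
Proof. by elim: n => [//|n ih] [/ih]. Qed.

Lemma closed_argmins n y : closed (argmins n y).
Proof.
elim: n => [|n ih]; first exact: closed_slice.
rewrite (_ : argmins _ _ = argmins n y `&` \bigcap_(u' in argmins n y)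
    [set u | (G `&` [set p | g n p <= g n (y, u')]) (y, u)]).
  by apply: closedI => //; apply: closed_bigI => u' _; apply: closed_slice; exact: lg.
apply/seteqP; split=> u [Au h]; split => // u' /h //.
  by move=> ?; split => //; exact: argmins_sub Au.
by case.
Qed.

Let lsc_slice n y C : closed C -> C `<=` argmins n y ->
  lsc_on C (fun u => g n (y, u)).
Proof.
move=> cC CA c.
rewrite (_ : _ `&` _ = C `&` [set u | (G `&` [set p | g n p <= c]) (y, u)]).
  by apply: closedI => //; apply: closed_slice; exact: lg.
apply/seteqP; split=> u [Cu h]; split => //; last by case: h.
by split => //; apply: argmins_sub (CA _ Cu).
Qed.

Let compactZ (C : set Z) : closed C -> compact C.
Proof. by move=> cC; apply: subclosed_compact cC kZ _. Qed.

Lemma argmins_neq0 n y : (exists u, G (y, u)) -> argmins n y !=set0.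
Proof.
move=> Gy; elim: n => [//|n ih].
have [u Au uP] := lsc_on_min (compactZ (@closed_argmins n y)) ih
  (lsc_slice (@closed_argmins n y) (@subset_refl _ _)).
by exists u.
Qed.

Let P n (C : set (T * Z)) : set (borel T) :=
  [set y | exists2 u, argmins n y u & C (y, u)].

(** For [n = 0] the set is the projection of a compact set. For the step, when [argmins n y] is
    nonempty, [C] contains a minimizer exactly when every rational level reached by [g n] on
    [argmins n y] is already reached inside [C]: a countable condition on sets covered by the
    induction. *)
Lemma argmins_measurable n C : closed C -> measurable (P n C).
Proof.
elim: n C => [|n ih] C cC.
  rewrite (_ : P 0 C = fst @` (G `&` C)); last first.
    apply/seteqP; split=> [y [u Gu Cu]|y [[y' u] [Gu Cu] <-]]; last by exists u.
    by exists (y, u).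
  apply: closed_borel; apply: compact_closed => //; apply: continuous_compact.
    by apply: continuous_subspaceT => x; exact: cvg_fst.
  exact: compact_closedI.
pose L (q : rat) := G `&` [set p | g n p <= ratr q].
have cL q : closed (L q) by exact: lg.
rewrite (_ : P n.+1 C = P n setT `&`
    ~` \bigcup_(q : rat) (P n (L q) `\` P n (C `&` L q))).
  apply: measurableI; first by apply: ih; exact: closedT.
  apply: measurableC; apply: bigcupT_measurable_rat => q; apply: measurableD.
    exact: ih.
  by apply: ih; apply: closedI.
apply/seteqP; split=> y.
  move=> [u [Au umin] Cu]; split; first by exists u.
  move=> [q _ [[u' Au' [_ /= u'q]]]]; apply; exists u => //; split => //.
  by split; [exact: argmins_sub Au|exact: (le_trans (umin _ Au') u'q)].
move=> [[u Au _] yP]; have Gy : exists u, G (y, u).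
  by exists u; exact: argmins_sub Au.
have key q u' : argmins n y u' -> g n (y, u') <= ratr q ->
    exists2 u, argmins n y u & C (y, u) /\ g n (y, u) <= ratr q.
  move=> Au' u'q; apply: contrapT => nex; apply: yP; exists q => //; split.
    by exists u' => //; split => //; exact: argmins_sub Au'.
  by move=> [u1 Au1 [Cu1 [_ u1q]]]; apply: nex; exists u1.
have [u0 Au0 u0min] := lsc_on_min (compactZ (@closed_argmins n y))
  (argmins_neq0 n Gy) (lsc_slice (@closed_argmins n y) (@subset_refl _ _)).
pose D := argmins n y `&` [set u | C (y, u)].
have cD : closed D by apply: closedI; [exact: closed_argmins|exact: closed_slice].
have D0 : D !=set0.
  have /rat_in_itvoo[q] : g n (y, u0) < g n (y, u0) + 1 by rewrite ltrDl.
  rewrite in_itv/= => /andP[/ltW /(key _ _ Au0)[u1 Au1 [Cu1 _]] _].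
  by exists u1.
have [u1 [Au1 Cu1] u1min] := lsc_on_min (compactZ cD) D0
  (lsc_slice cD (@subIsetl _ _ _)).
exists u1 => //; split => // u' Au'; apply: le_trans (u0min _ Au').
rewrite leNgt; apply/negP => /rat_in_itvoo[q]; rewrite in_itv/= => /andP[u0q qu1].
have [u2 Au2 [Cu2 u2q]] := key q u0 Au0 (ltW u0q).
have : g n (y, u1) <= g n (y, u2) by apply: u1min.
by move=> /le_trans/(_ u2q); rewrite leNgt qu1.
Qed.

Context (sep : forall y u u', G (y, u) -> G (y, u') ->
  (forall n, g n (y, u) = g n (y, u')) -> u = u').

Lemma measurable_argmins : exists sigma : T -> Z,
  (forall Y, (forall y, Y y -> exists u, G (y, u)) -> borel_fun Y sigma) /\
  forall y, (exists u, G (y, u)) -> forall n, argmins n y (sigma y).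
Proof.
pose sigma y := xget point (\bigcap_n argmins n y).
(* By compactness a closed [F] that meets every [argmins n y] meets their intersection, which [sep]
   reduces to the point [sigma y]. Preimages of closed sets thus become countable intersections of
   measurable sets. *)
have sP y F : (exists u, G (y, u)) -> closed F ->
    (forall n, exists2 u, argmins n y u & F u) -> F (sigma y) /\
    forall n, argmins n y (sigma y).
  move=> Gy cF AF.
  have [u uP] : \bigcap_n (argmins n y `&` F) !=set0.
    apply: compact_bigcap_nat => // n.
    - by apply: closedI => //; exact: closed_argmins.
    - by move=> x [[]].
    - by have [u] := AF n; exists u.
  have uA n : argmins n y u by have [] := uP n I.
  suff -> : sigma y = u by split => //; have [] := uP 0%N I.
  have sA : (\bigcap_n argmins n y) (sigma y).
    by apply: xgetPex; exists u.
  apply: (sep (y := y)); [exact: (argmins_sub (sA 0%N I))|exact: (uA 0%N)|move=> n].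
  have [_ s1] := sA n.+1 I; have [_ u1] := uA n.+1.
  by apply/eqP; rewrite eq_le; apply/andP; split; [apply: s1; exact: uA|apply: u1; exact: sA].
have sA y : (exists u, G (y, u)) -> forall n, argmins n y (sigma y).
  move=> Gy; have [] // := sP y setT Gy closedT.
  by move=> n; have [u] := argmins_neq0 n Gy; exists u.
exists sigma; split => // Y YG.
have mF (F : set Z) : closed F -> Y `&` sigma @^-1` F =
    Y `&` \bigcap_n P n [set p | F p.2].
  move=> cF; apply/seteqP; split=> y [Yy yF]; split => //.
    by move=> n _; exists (sigma y) => //; apply: sA; exact: YG.
  by have [] := sP y F (YG _ Yy) cF (fun n => yF n I).
move=> mY; apply: (@measurability _ _ (borel T) (borel Z) Y sigma (@open Z)) => //.
move=> _ [ O oO <-].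
rewrite (_ : _ `&` _ = Y `\` (Y `&` sigma @^-1` (~` O))); last first.
  apply/seteqP; split=> y [Yy h]; split => //; first by case.
  by apply: contrapT => ?; apply: h.
apply: measurableD => //; rewrite mF; last exact: open_closedC.
apply: measurableI => //; apply: bigcapT_measurable => n.
apply: argmins_measurable; apply: preimage_closed; last exact: open_closedC.
by move=> x _; exact: cvg_snd.
Qed.

End iterated_argmin.

Lemma measurable_selection (g : T * Z -> R) : lsc_on G g ->
  exists sigma : T -> Z,
  (forall Y, (forall y, Y y -> exists u, G (y, u)) -> borel_fun Y sigma) /\
  forall y, (exists u, G (y, u)) ->
    G (y, sigma y) /\ forall u, G (y, u) -> g (y, sigma y) <= g (y, u).
Proof.
move=> lg.
have /choice[net netP] : forall i : nat, exists s : seq Z,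
    forall x, exists2 y, y \in s & ball y i.+1%:R^-1 x.
  move=> i; have i0 : 0 < i.+1%:R^-1 :> R by rewrite invr_gt0.
  have [s [_ sP]] := compact_subcover kZ (fun x _ => nbhsx_ballx x _ i0).
  by exists s => x; exact: sP.
(* Distances to the points of finer and finer finite nets determine a point. A net and a rank in it
   are coded by one natural number; codes of no pair give the constant 0, which excludes no
   minimizer. *)
pose dst (m : nat) (p : T * Z) : R :=
  if @choice.unpickle (nat * nat)%type m is Some (i, j) then mdist (nth point (net i) j) p.2 else 0.
pose gs n := if n is n'.+1 then dst n' else g.
have lgs n : lsc_on G (gs n).
  case: n => [//|n] c /=; rewrite /dst; case: choice.unpickle => [[i j]|].
    apply: closedI => //.
    apply: (@preimage_closed (T * Z)%type Z snd
      [set u | mdist (nth point (net i) j) u <= c]); last exact: closed_mdist_le.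
    by move=> x _; exact: cvg_snd.
  have [c0|c0] := leP 0 c.
    by rewrite (_ : [set _ | _] = setT) ?setIT//; exact/seteqP.
  rewrite (_ : _ `&` _ = set0); first exact: closed0.
  by rewrite -subset0 => x [].
have sep y u u' : G (y, u) -> G (y, u') ->
    (forall n, gs n (y, u) = gs n (y, u')) -> u = u'.
  move=> _ _ e; apply/eqP/negPn/negP; rewrite -mdist_gt0 => uu'.
  (* A net point closer to [u] than half the distance from [u] to [u'] cannot be equally far from
     both. *)
  have /ltr_add_invr[i] : 0 < mdist u u' / 2 :> R by rewrite divr_gt0.
  rewrite add0r => iu; have [z zi] := netP i u; rewrite ballEmdist/= => zu.
  have zu' : mdist z u = mdist z u'.
    have := e (choice.pickle (i, index z (net i))).+1.
    by rewrite /gs /dst choice.pickleK/= nth_index.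
  have := metric_triangle u z u'; rewrite (metric_sym u z) -zu' leNgt.
  by rewrite [ltRHS]splitr ltrD// (lt_trans zu iu).
have [sigma [ms sA]] := measurable_argmins lgs sep.
exists sigma; split=> // y Gy; split; first exact: (sA y Gy 0%N).
by have [_ h] := sA y Gy 1%N; move=> u; exact: h.
Qed.

End measurable_selection.

(** * Independence and mixtures *)

(* The sets N can be taken to be rectangles when X is a product space, which
   spares comparing its Borel sigma-algebra with the product one. *)
Lemma compact_valued_measurable {R : realType} (X : pseudoPMetricType R) (K : set X)
    d (T : measurableType d) (F : T -> X) :
  compact K -> (forall w, K (F w)) ->
  (forall x (e : R), 0 < e -> exists N : set X,
     [/\ nbhs x N, N `<=` ball x e & measurable (F @^-1` N)]) ->
  @measurable_fun _ _ T (borel X) setT F.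
Proof.
move=> kK FK FN.
have mc (C : set X) : closed C -> measurable (F @^-1` C).
  move=> cC; have [N NP] : exists N : nat -> X -> set X, forall j x,
      [/\ nbhs x (N j x), N j x `<=` ball x (j.+1%:R^-1 : R) &
      measurable (F @^-1` (N j x))].
    have /choice[N NP] : forall jx : nat * X, exists M : set X,
        [/\ nbhs jx.2 M, M `<=` ball jx.2 (jx.1.+1%:R^-1 : R) &
        measurable (F @^-1` M)].
      by move=> jx; apply: FN; rewrite invr_gt0.
    by exists (fun j x => N (j, x)) => j x; exact: (NP (j, x)).
  have /choice[s sP] : forall j, exists s : seq X,
      forall x, K x -> exists2 y, y \in s & N j y x.
    move=> j; have [|s [_ sP]] := compact_subcover (N := N j) kK.
      by move=> x _; have [] := NP j x.
    by exists s.
  pose near_C j x := `[< exists2 c, C c & ball x (j.+1%:R^-1 : R) c >].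
  rewrite (_ : F @^-1` C =
    \bigcap_j \big[setU/set0]_(x <- s j | near_C j x) (F @^-1` (N j x))).
    apply: bigcapT_measurable => j; apply: bigsetU_measurable => x _.
    by have [] := NP j x.
  apply/seteqP; split=> w.
    move=> Cw j _; have [x xs Nx] := sP j _ (FK w).
    rewrite -bigcup_seq_cond; exists x => //=; rewrite xs/=.
    apply/asboolP; exists (F w) => //; have [_ + _] := NP j x; exact.
  move=> h; apply: cC => A; rewrite -nbhs_ballE => -[e /= e0 eA].
  have [j] := ltr_add_invr (divr_gt0 e0 (ltr0Sn R 1)); rewrite add0r => je.
  have := h j I; rewrite -bigcup_seq_cond => -[x /= /andP[xs /asboolP[c Cc xc]] Nx].
  exists c; split => //; apply: eA; rewrite [e]splitr.
  apply: (@ball_triangle _ _ x); apply: (le_ball (ltW je)) => //.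
  by apply: ball_sym; have [_ + _] := NP j x; exact.
move=> _; apply: (@measurability _ _ T (borel X) setT F (@open X)) => //.
move=> _ [ O oO <-]; rewrite setTI -[ O]setCK preimage_setC; apply: measurableC.
exact: (mc _ (open_closedC oO)).
Qed.

(** Independence is given for sets. At every mesh the layer sums of the two sides agree up to the
    factor [P A], hence so do the integrals. *)
Lemma indep_integral {R : realType} d d' (Omega : measurableType d)
    (T : measurableType d') (P : probability Omega R) (A : set Omega)
    (X1 X0 : Omega -> T) (g : T -> R) :
  measurable A -> measurable_fun setT X1 -> measurable_fun setT X0 ->
  (forall B, measurable B -> P (A `&` X1 @^-1` B) = (P A * P (X0 @^-1` B))%E) ->
  bmf [set: T] g ->
  \int[P]_(w in A) g (X1 w) = fine (P A) * \int[P]_w g (X0 w).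
Proof.
move=> mA m1 m0 ind bg.
have cb (D : set Omega) X : measurable_fun setT X -> bmf D (g \o X).
  move=> mX; have [mg [M gM]] := bg; split; last by exists M => w _; exact: gM.
  by apply: (@measurable_funS _ _ _ _ setT) => //; exact: measurableT_comp.
have PA0 : 0 <= fine (P A) by exact: fine_ge0.
have PA1 : fine (P A) <= 1.
  by rewrite -lee_fin fineK ?fin_num_measure//; exact: probability_le1.
(* Layers require a nonnegative function; shifting [g] by a bound [M] adds [M * P A] to both
   sides. *)
wlog g0 : g bg cb / forall x, 0 <= g x => [hw|].
  have [_ [M gM]] := bg.
  have h x : 0 <= g x + M by have := gM x I; rewrite ler_norml => /andP[? _]; lra.
  have bgM : bmf [set: T] (fun x => g x + M) by apply: bmfD => //; exact: bmf_cst.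
  have := hw (fun x => g x + M) bgM _ h.
  rewrite RintegralD//; [|by apply: bmf_integrable => //; exact: (cb _ X1)|
    by apply: bmf_integrable => //; exact: bmf_cst].
  rewrite RintegralD//; [|by apply: bmf_integrable => //; exact: (cb _ X0)|
    by apply: bmf_integrable => //; exact: bmf_cst].
  rewrite !Rintegral_cst// (congr1 fine (probability_setT P)) mulr1 mulrDr.
  rewrite (mulrC M) => /(_ _)/addIr; apply => D X mX.
  by apply: bmfD; [exact: cb|exact: bmf_cst].
have [_ [M gM]] := bg.
suff key e : 0 < e -> \int[P]_(w in A) g (X1 w) <= fine (P A) * \int[P]_w g (X0 w) + e /\
    fine (P A) * \int[P]_w g (X0 w) <= \int[P]_(w in A) g (X1 w) + e.
  by apply/eqP; rewrite eq_le; apply/andP; split;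
    apply/ler_addgt0Pr => e e0; have [] := key e e0.
move=> e0; pose n := Num.truncn (M / e).
have gn x : g x <= e * n.+1%:R.
  apply: le_trans (le_trans (ler_norm _) (gM x I)) _.
  by have := truncnS_gt (M / e); rewrite ltr_pdivrMr// mulrC => /ltW.
have l1 := layers_le mA (cb A X1 m1) (fun w _ => g0 (X1 w)) P n e0.
have u1 := layers_ge mA (cb A X1 m1) (fun w _ => g0 (X1 w)) P e0 (fun w _ => gn (X1 w)).
have l0 := layers_le measurableT (cb setT X0 m0) (fun w _ => g0 (X0 w)) P n e0.
have u0 := layers_ge measurableT (cb setT X0 m0) (fun w _ => g0 (X0 w)) P e0
  (fun w _ => gn (X0 w)).
have E : layers A (g \o X1) P e n = fine (P A) * layers setT (g \o X0) P e n.
  rewrite /layers mulr_sumr; apply: eq_bigr => i _; rewrite mulrCA; congr (_ * _).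
  have mB : measurable (g @^-1` `]e * i.+1%:R, +oo[).
    by rewrite -[X in measurable X]setTI; apply: bg.1.
  have := ind _ mB; rewrite preimage_itvoy setTI.
  rewrite -[A `&` _]/(A `&` [set x | e * i.+1%:R < g (X1 x)]) => ->.
  rewrite fineM ?fin_num_measure//.
  rewrite -[X0 @^-1` _]setTI; apply: m0 => //.
  by move: mB; rewrite preimage_itvoy.
split.
  apply: le_trans u1 _; rewrite E lerD2r; exact: ler_wpM2l l0.
have := ler_wpM2l PA0 u0; rewrite mulrDr -E => h; apply: le_trans h _.
by rewrite lerD// ger_pMl.
Qed.


Section mixture.
Context {R : realType} d (Omega : measurableType d) (P : probability Omega R).
Context d' (T : measurableType d') (X : nat -> Omega -> T).
Context (mX : forall t, measurable_fun setT (X t)).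
Context (c : nat -> R) (c0 : forall t, 0 <= c t) (c1 : series c @ \oo --> (1 : R)).

Let X' t : {mfun Omega >-> T} := HB.pack (X t) (isMeasurableFun.Build _ _ _ _ (X t) (mX t)).

Let m_ t : {measure set T -> \bar R} := mscale (NngNum (c0 t)) (distribution P (X' t)).

Definition mixture : set T -> \bar R := mseries m_ 0.

HB.instance Definition _ := Measure.on mixture.

Let mixtureE D : measurable D -> (forall t w, D (X t w)) -> mixture D = 1%E.
Proof.
move=> mD XD; rewrite /mixture /mseries.
have e : (fun n => \sum_(0 <= k < n) m_ k D) = EFin \o series c.
  apply/funext => n /=; rewrite /series/= -sumEFin; apply: eq_bigr => t _.
  rewrite /m_ /mscale/= /distribution /pushforward (_ : _ @^-1` _ = setT) ?probability_setT ?mule1//.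
  by apply/seteqP; split=> // w _; exact: XD.
by rewrite e; apply/cvg_lim => //; apply: cvg_EFin => //; exact: nearW.
Qed.

Let mixture_setT : mixture setT = 1%E.
Proof. by apply: mixtureE. Qed.

HB.instance Definition _ := Measure_isProbability.Build _ _ R mixture mixture_setT.

Let ge0_integral_mixture D (g : T -> R) : measurable D -> (forall t w, D (X t w)) ->
  bmf D g -> (forall x, D x -> 0 <= g x) ->
  series (fun t => c t * \int[P]_w g (X t w)) @ \oo --> \int[mixture]_(x in D) g x.
Proof.
move=> mD XD bg g0.
have bgX t : bmf setT (fun w => g (X t w)).
  have [mg [M gM]] := bg; split; last by exists M => w _; exact: gM.
  by apply: (measurable_comp (F := D)) => // _ [w _ <-].
have mE : measurable_fun D (EFin \o g) by apply/measurable_EFinP; case: bg.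
have g0E x : D x -> (0 <= (g x)%:E)%E by move=> /g0; rewrite lee_fin.
have e t : (\int[m_ t]_(x in D) (g x)%:E = (c t * \int[P]_w g (X t w))%:E)%E.
  rewrite /m_ ge0_integral_mscale//= /distribution ge0_integral_pushforward//; last first.
    by move=> x; rewrite inE => /g0E.
  rewrite EFinM; congr (_ * _)%E.
  rewrite (_ : _ @^-1` _ = setT); last first.
    by apply/seteqP; split=> // w _; exact: XD.
  rewrite /Rintegral fineK//; apply: integrable_fin_num => //.
  exact: (bmf_integrable P measurableT (bgX t)).
have L : (\int[mixture]_(x in D) (g x)%:E =
    \sum_(0 <= t <oo) (c t * \int[P]_w g (X t w))%:E)%E.
  rewrite (ge0_integral_measure_series m_ mD g0E mE).
  by apply: eq_eseriesr => t _; exact: e.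
have fin : (\int[mixture]_(x in D) (g x)%:E)%E \is a fin_num.
  by apply: integrable_fin_num => //; exact: (bmf_integrable mixture mD bg).
have u0 t : 0 <= c t * \int[P]_w g (X t w).
  by apply: mulr_ge0 => //; apply: Rintegral_ge0 => w _; exact: g0.
have := @is_cvg_nneseries R (fun t => (c t * \int[P]_w g (X t w))%:E) xpredT 0.
move=> /(_ (fun t _ _ => u0 t)).
move=> /cvg_ex[l cl]; have := cl => /cvg_lim; rewrite -L => /(_ (@ereal_hausdorff R)) lE.
move: cl; rewrite -lE => cl; rewrite /Rintegral.
have := fine_cvg; move=> /(_ _ _ _ _ (fun n => \sum_(0 <= t < n) (c t * \int[P]_w g (X t w))%:E)%E (fine (\int[mixture]_(x in D) (g x)%:E)%E)).
rewrite fineK// => /(_ \oo _ cl).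
suff -> : series (fun t => c t * \int[P]_w g (X t w)) =
  fine \o (fun n => \sum_(0 <= t < n) (c t * \int[P]_w g (X t w))%:E)%E by [].
by apply/funext => n /=; rewrite sumEFin.
Qed.

Lemma integral_mixture D : measurable D -> (forall t w, D (X t w)) ->
  exists gam : probability T R, gam D = 1%E /\ forall g, bmf D g ->
    series (fun t => c t * \int[P]_w g (X t w)) @ \oo --> \int[gam]_(x in D) g x.
Proof.
move=> mD XD; exists mixture; split; first exact: mixtureE.
move=> g bg; have [mg [M gM]] := bg.
have g0 x : D x -> 0 <= g x + M.
  by move=> /gM; rewrite ler_norml => /andP[? _]; lra.
have bgM : bmf D (fun x => g x + M) by apply: bmfD => //; exact: bmf_cst.
have h1 := ge0_integral_mixture mD XD bgM g0.
(* Nonnegative integrands give monotone series. A bounded one is shifted by [M]; since the weights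
   sum to 1, the shift itself contributes exactly [M]. *)
have h2 : series (fun t => c t * M) @ \oo --> M.
  rewrite -[X in _ --> X]mul1r.
  rewrite (_ : series _ = (fun n => series c n * M)); first exact: cvgMr_tmp.
  by apply/funext => n; rewrite /series/= mulr_suml.
have := cvgB h1 h2.
rewrite RintegralD//; [|exact: bmf_integrable|
  by apply: bmf_integrable => //; exact: bmf_cst].
rewrite Rintegral_cst// (congr1 fine (mixtureE mD XD)) mulr1 addrK.
suff -> : series (fun t => c t * \int[P]_w g (X t w)) =
  (fun n => series (fun t => c t * \int[P]_w (g (X t w) + M)) n -
            series (fun t => c t * M) n) by move=> h; exact: h.
apply/funext => n; rewrite /series/= -sumrB.
apply: eq_bigr => t _; rewrite -mulrBr; congr (_ * _).
rewrite RintegralD// ?Rintegral_cst//.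
- by rewrite (congr1 fine (probability_setT P)) mulr1 addrK.
- apply: (bmf_integrable (g := fun w => g (X t w))) => //.
  split; last by exists M => w _; exact: gM.
  by apply: (measurable_comp (F := D)) => // _ [w _ <-].
- by apply: (bmf_integrable (g := fun=> M)) => //; exact: bmf_cst.
Qed.

End mixture.


(** * The control system *)

Section sequential_continuity.
Context {R : realType} (X : pseudoPMetricType R) (D : set X).

(** Sequential, since continuity of [Enext] comes from bounded convergence, which speaks of
    sequences. *)
Definition seq_continuous_on (g : X -> R) :=
  forall (x_ : nat -> X) x, (forall i, D (x_ i)) -> D x ->
    x_ @ \oo --> x -> g \o x_ @ \oo --> g x.

Lemma closure_seq (A : set X) x : closure A x ->
  exists2 x_ : nat -> X, (forall i, A (x_ i)) & x_ @ \oo --> x.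
Proof.
move=> cA; have /choice[x_ xP] : forall i : nat, exists y,
    A y /\ ball x i.+1%:R^-1 y.
  move=> i; have [y [Ay xy]] : A `&` ball x (i.+1%:R^-1 : R) !=set0.
    by apply: cA; apply: nbhsx_ballx; rewrite invr_gt0.
  by exists y.
exists x_ => [i|]; first by have [] := xP i.
apply/cvg_ballP => e e0; near=> i; have [_] := xP i.
apply: le_ball; apply: ltW; near: i; exact: near_infty_natSinv_lt (PosNum e0).
Unshelve. all: by end_near. Qed.

Lemma seq_continuous_lsc_on g : closed D -> seq_continuous_on g -> lsc_on D g.
Proof.
move=> cD cg c x cx; have [x_ x_P xx] := closure_seq cx.
have Dx : D x by apply: cD => A /cx; apply: subsetI_neq0.
split => //=.
apply: cvg_ler_near (cg _ _ _ Dx xx) (cvg_cst c) _; first by move=> i; have [] := x_P i.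
by apply: nearW => i; have [] := x_P i.
Qed.

Lemma seq_continuous_onD g1 g2 : seq_continuous_on g1 -> seq_continuous_on g2 ->
  seq_continuous_on (fun x => g1 x + g2 x).
Proof. by move=> c1 c2 x_ x Dx_ Dx xx; apply: cvgD; [exact: c1|exact: c2]. Qed.

Lemma seq_continuous_onZ c g : seq_continuous_on g ->
  seq_continuous_on (fun x => c * g x).
Proof. by move=> cg x_ x Dx_ Dx xx; apply: cvgMl_tmp; exact: cg. Qed.

End sequential_continuity.

Lemma ExE {R : realType} d (Omega : measurableType d) (P : probability Omega R)
  (X : Omega -> R) : Ex P X = \int[P]_w X w.
Proof. by rewrite /Ex unlock. Qed.

Section system.
Context {R : realType} {n : nat} {Uh : pmetricType R} {S : ptopologicalType}.
Context {d : measure_display} {Omega : measurableType d}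
  {P : probability Omega R} {s : nat -> Omega -> S}.
Context {Y : set 'rV[R]_n} {U : 'rV[R]_n -> set Uh}
  {f : 'rV[R]_n -> Uh -> S -> 'rV[R]_n} {k : 'rV[R]_n -> Uh -> R}.
Context (Y_nonempty : Y !=set0) (Y_compact : compact Y)
  (Uh_compact : compact [set: Uh])
  (f_continuous : forall z,
    {within Y `*` [set: Uh], continuous (fun p => f p.1 p.2 z)})
  (f_measurable : forall y u, Y y -> borel_fun [set: S] (f y u))
  (s_iid : iid P s)
  (U_usc : upper_semicontinuous_on Y U)
  (U_nonempty : forall y, Y y -> U y !=set0)
  (U_compact : forall y, Y y -> compact (U y))
  (f_invariant : forall y u z, Y y -> U y u -> Y (f y u z))
  (k_continuous : {within Y `*` [set: Uh], continuous (fun p => k p.1 p.2)}).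

Implicit Types (phi psi : 'rV[R]_n -> R) (p : 'rV[R]_n * Uh).

Local Notation G := (graph Y U).
Local Notation next phi := (fun p => Enext P s f phi p.1 p.2).

Let Y_closed : closed Y.
Proof. by apply: compact_closed => //; exact: norm_hausdorff. Qed.

Lemma graph_closed : closed G.
Proof.
rewrite -[X in closed X]setCK; apply: open_closedC; rewrite openE => -[y u] nG.
have [Yy|nYy] := pselect (Y y); last first.
  exists (~` Y, setT) => /=; last by move=> [y' u'] /= [nY _] [].
  split; last exact: filterT.
  by apply: open_nbhs_nbhs; split => //; exact: closed_openC.
have cU : closed (U y).
  by apply: compact_closed; [exact: (@metric_hausdorff R Uh)|exact: U_compact].
have : nbhs u (~` U y).
  apply: open_nbhs_nbhs; split; first exact: closed_openC.
  by move=> Uu; exact: nG.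
rewrite -nbhs_ballE => -[e /= e0 ue].
(* Upper semicontinuity is applied to the complement of a closed ball of half the radius that
   separates [u] from [U y]: for [y'] near [y], [U y'] stays out of that ball. *)
have oV : open (~` [set t | mdist u t <= e / 2]).
  by apply: closed_openC; exact: closed_mdist_le.
have UV : U y `<=` ~` [set t | mdist u t <= e / 2].
  move=> t Ut /= h; apply: (ue t) => //; rewrite ballEmdist/=.
  by apply: le_lt_trans h _; rewrite ltr_pdivrMr// ltr_pMr// ltr1n.
have := U_usc Yy oV UV; rewrite /= near_withinE => nU.
exists ([set x' | Y x' -> U x' `<=` ~` [set t | mdist u t <= e / 2]],
  ball u (e / 2)) => /=.
  by split => //; apply: nbhsx_ballx; rewrite divr_gt0.
move=> [y' u'] /= [h uu'] [Yy' Uu']; apply: (h Yy' _ Uu') => /=.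
by move: uu'; rewrite ballEmdist => /ltW.
Qed.

Lemma graph_compact : compact G.
Proof.
apply: (@subclosed_compact _ _ (Y `*` [set: Uh])); first exact: graph_closed.
  exact: compact_setX.
by move=> p [].
Qed.

Lemma graph_measurable : measurable (G : set (borel ('rV[R]_n * Uh)%type)).
Proof. by apply: closed_borel; exact: graph_closed. Qed.

Let G_ex y : Y y -> exists u, G (y, u).
Proof. by move=> Yy; have [u Uu] := U_nonempty Yy; exists u. Qed.

Lemma seq_continuous_cost : seq_continuous_on G (fun p => k p.1 p.2).
Proof.
move=> x_ x Gx_ Gx; apply: (within_cvg (D := Y `*` [set: Uh])) => //.
  by case: Gx.
by move=> i; case: (Gx_ i).
Qed.

Lemma seq_continuous_state (phi : 'rV[R]_n -> R) :
  {within Y, continuous phi} -> seq_continuous_on G (fun p => phi p.1).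
Proof.
move=> cphi x_ x Gx_ Gx xx.
apply: (within_cvg (D := Y) (x_ := fun i => (x_ i).1)) => //.
- by case: Gx.
- by move=> i; case: (Gx_ i).
- by apply: (cvg_comp _ _ xx); exact: cvg_fst.
Qed.

Let s_measurable t : @measurable_fun _ _ Omega (borel S) setT (s t).
Proof. by case: s_iid. Qed.

Lemma next_bmf phi p t : lsc_on Y phi -> bounded_on Y phi -> G p ->
  bmf [set: Omega] (fun w => phi (f p.1 p.2 (s t w))) /\
  bmf [set: borel S] (fun z => phi (f p.1 p.2 z)).
Proof.
move=> lphi [M phiM] [Yp Up].
have mf : measurable_fun [set: borel S] (fun z => phi (f p.1 p.2 z)).
  apply: (@measurable_comp _ _ _ (borel S) (borel 'rV[R]_n) R Y phi).
  - exact: closed_borel.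
  - by move=> _ [z _ <-]; exact: f_invariant.
  - exact: lsc_on_measurable.
  - exact: f_measurable.
have b z : `|phi (f p.1 p.2 z)| <= M by apply: phiM; exact: f_invariant.
split; split => //; try by exists M => x _; exact: b.
by apply: (measurableT_comp (f := fun z : borel S => phi (f p.1 p.2 z))).
Qed.

Lemma next_bounded phi M p : lsc_on Y phi -> (forall y, Y y -> `|phi y| <= M) ->
  G p -> `|next phi p| <= M.
Proof.
move=> lphi phiM Gp; have bphi : bounded_on Y phi by exists M.
have [b _] := next_bmf 0 lphi bphi Gp.
rewrite /Enext ExE; apply: (Rintegral_norm_le (mu := P) measurableT (probability_setT P) b).
by move=> w _; apply: phiM; case: Gp => *; exact: f_invariant.
Qed.

Lemma next_le phi psi p : lsc_on Y phi -> bounded_on Y phi ->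
  lsc_on Y psi -> bounded_on Y psi -> (forall y, Y y -> phi y <= psi y) ->
  G p -> next phi p <= next psi p.
Proof.
move=> l1 b1 l2 b2 le12 Gp; rewrite /Enext !ExE; apply: le_Rintegral => //.
- by apply: bmf_integrable => //; apply: (next_bmf _ _ _ Gp).1.
- by apply: bmf_integrable => //; apply: (next_bmf _ _ _ Gp).1.
- by move=> w _; apply: le12; case: Gp => *; exact: f_invariant.
Qed.

Lemma next_cvg (phi_ : nat -> 'rV[R]_n -> R) phi M p :
  (forall j, lsc_on Y (phi_ j)) -> (forall j y, Y y -> `|phi_ j y| <= M) ->
  (forall y, Y y -> phi_ j y @[j --> \oo] --> phi y) -> G p ->
  next (phi_ j) p @[j --> \oo] --> next phi p.
Proof.
move=> l_ M_ cvg_ Gp; rewrite /Enext ExE; under eq_fun do rewrite ExE.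
have [||||_ //] := (@bounded_cvg _ Omega R P setT
  (fun j w => phi_ j (f p.1 p.2 (s 0%N w))) (fun w => phi (f p.1 p.2 (s 0%N w))) M).
- exact: measurableT.
- move=> j; have bj : bounded_on Y (phi_ j) by exists M => y; exact: M_.
  by have [[]] := next_bmf 0 (l_ j) bj Gp.
- by move=> j w _; apply: M_; case: Gp => *; exact: f_invariant.
- by move=> w _; apply: cvg_; case: Gp => *; exact: f_invariant.
Qed.

Lemma seq_continuous_after phi z : {within Y, continuous phi} ->
  seq_continuous_on G (fun p => phi (f p.1 p.2 z)).
Proof.
move=> cphi x_ x Gx_ Gx xx; apply: (within_cvg (D := Y)) => //.
- by case: Gx => *; exact: f_invariant.
- by move=> i; case: (Gx_ i) => *; exact: f_invariant.
apply: (within_cvg (D := Y `*` [set: Uh]) (x_ := x_)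
  (g := fun p => f p.1 p.2 z)) => //.
- by case: Gx.
- by move=> i; case: (Gx_ i).
Qed.

(** Feller property of the controlled transition kernel: [f] is continuous for each fixed noise, and
    bounded convergence integrates this. *)
Lemma seq_continuous_next phi : {within Y, continuous phi} ->
  seq_continuous_on G (next phi).
Proof.
move=> cphi x_ x Gx_ Gx xx; rewrite /Enext /comp ExE; under eq_fun do rewrite ExE.
have lphi := within_lsc_on Y_closed cphi.
have [M phiM] := within_bounded_on Y_compact Y_closed cphi.
have [||||_ //] := (@bounded_cvg _ Omega R P setT
  (fun j w => phi (f (x_ j).1 (x_ j).2 (s 0%N w)))
  (fun w => phi (f x.1 x.2 (s 0%N w))) M).
- exact: measurableT.
- move=> j; have bj : bounded_on Y phi by exists M => y; exact: phiM.
  by have [[]] := next_bmf 0 lphi bj (Gx_ j).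
- by move=> j w _; apply: phiM; case: (Gx_ j) => *; exact: f_invariant.
- by move=> w _; exact: (@seq_continuous_after phi (s 0%N w) cphi _ _ Gx_ Gx xx).
Qed.


Lemma cost_bounded : exists2 Mk, 0 <= Mk & forall p, G p -> `|k p.1 p.2| <= Mk.
Proof.
have [M kM] : bounded_on (Y `*` [set: Uh]) (fun p => k p.1 p.2).
  apply: within_bounded_on => //; first exact: compact_setX.
  rewrite setXT; apply: preimage_closed => // x _; exact: cvg_fst.
have [y Yy] := Y_nonempty; have [u Uu] := U_nonempty Yy.
exists M => [|p [Yp _]]; last exact: kM.
by apply: le_trans (kM (y, u) _).
Qed.

(** * The Bellman operator *)

Definition objective (a b : R) (V : 'rV[R]_n -> R) p : R :=
  a * k p.1 p.2 + b * next V p.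

(** The weights [a], [b] are [eps], [1 - eps] in the discounted problem and [1], [1] for a finite
    horizon; [objective 0 1 V] is [Enext] of [V], which yields its semicontinuity. *)
Definition bellman (a b : R) (V : 'rV[R]_n -> R) y : R :=
  inf [set objective a b V (y, u) | u in U y].

(** Continuous approximants of [V] from below make the objective a supremum of continuous functions,
    because [Enext] is monotone and passes to their limit. *)
Lemma objective_lsc a b V : 0 <= b -> lsc_on Y V -> bounded_on Y V ->
  lsc_on G (objective a b V).
Proof.
move=> b0 lV [M VM].
have [psi [cpsi psiM psiV psi_cvg]] := lsc_approx Y_nonempty lV VM.
have wpsi j : {within Y, continuous (psi j)} by exact: continuous_subspaceT.
have lpsi j : lsc_on Y (psi j) by exact: within_lsc_on.
have bpsi j : bounded_on Y (psi j) by exists M => y; exact: psiM.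
apply: (@lsc_on_sup _ _ _ _ setT (fun j => objective a b (psi j))).
- exact: graph_closed.
- move=> j _; apply: seq_continuous_lsc_on; first exact: graph_closed.
  apply: seq_continuous_onD; apply: seq_continuous_onZ.
    exact: seq_continuous_cost.
  exact: seq_continuous_next.
move=> p Gp c; split=> [h j _|h].
  apply: le_trans h; rewrite /objective lerD2l ler_wpM2l//.
  by apply: next_le => //; [exists M|move=> y; exact: psiV].
apply: (@cvg_ler_near R nat \oo _ (fun j => objective a b (psi j) p) (fun=> c)).
- rewrite /objective; apply: cvgD; first exact: cvg_cst.
  by apply: cvgMl_tmp; apply: (next_cvg (M := M)).
- exact: cvg_cst.
- by apply: nearW => j; exact: h.
Qed.

Lemma objective_bounded a b V Mk M p : 0 <= a -> 0 <= b -> lsc_on Y V ->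
  (forall y, Y y -> `|V y| <= M) -> (forall q, G q -> `|k q.1 q.2| <= Mk) ->
  G p -> `|objective a b V p| <= a * Mk + b * M.
Proof.
move=> a0 b0 lV VM kM Gp; apply: le_trans (ler_normD _ _) _.
rewrite !normrM (ger0_norm a0) (ger0_norm b0) lerD// ler_wpM2l//; first exact: kM.
exact: next_bounded.
Qed.

Lemma bellman_selector a b V : 0 <= b -> lsc_on Y V -> bounded_on Y V ->
  exists sigma : 'rV[R]_n -> Uh, [/\ borel_fun Y sigma,
    forall y, Y y -> U y (sigma y),
    forall y, Y y -> bellman a b V y = objective a b V (y, sigma y) &
    forall y u, Y y -> U y u -> bellman a b V y <= objective a b V (y, u)].
Proof.
move=> b0 lV bV; have lo := @objective_lsc a b V b0 lV bV.
have [sigma [ms sP]] := measurable_selection (@norm_hausdorff R 'rV[R]_n)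
  Uh_compact graph_closed graph_compact lo.
have bE y : Y y -> bellman a b V y = objective a b V (y, sigma y).
  move=> Yy; have [[_ Us] smin] := sP y (G_ex Yy).
  have lb : lbound [set objective a b V (y, u) | u in U y]
      (objective a b V (y, sigma y)).
    by move=> _ [u Uu <-]; apply: smin.
  apply/eqP; rewrite eq_le; apply/andP; split.
    by apply: ge_inf; [exists (objective a b V (y, sigma y))|exists (sigma y)].
  by apply: lb_le_inf => //; exists (objective a b V (y, sigma y)), (sigma y).
exists sigma; split => //.
- by apply: ms => y; exact: G_ex.
- by move=> y Yy; have [[]] := sP y (G_ex Yy).
- by move=> y u Yy Uu; rewrite bE//; apply: (sP y (G_ex Yy)).2.
Qed.

(** As the infimum is attained, a sublevel set is the projection of a sublevel set of the objective
    in the compact graph. *)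
Lemma bellman_lsc a b V : 0 <= b -> lsc_on Y V -> bounded_on Y V ->
  lsc_on Y (bellman a b V).
Proof.
move=> b0 lV bV c; have lo := @objective_lsc a b V b0 lV bV.
have [sigma [_ Us bE ble]] := @bellman_selector a b V b0 lV bV.
rewrite (_ : _ `&` _ = fst @` (G `&` [set p | objective a b V p <= c])).
  apply: compact_closed; first exact: norm_hausdorff.
  apply: continuous_compact; last first.
    by apply: subclosed_compact (lo c) graph_compact _ => p [].
  by apply: continuous_subspaceT => x; exact: cvg_fst.
apply/seteqP; split=> [y [Yy /= yc]|_ [[y u] [[/= Yy Uu] yc] <-]] /=.
  by exists (y, sigma y) => //; split; [split => //; exact: Us|rewrite /= -bE].
by split => //; apply: le_trans (ble _ _ Yy Uu) yc.
Qed.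

Lemma bellman_bounded a b V Mk M y : 0 <= a -> 0 <= b -> lsc_on Y V ->
  (forall y, Y y -> `|V y| <= M) -> (forall q, G q -> `|k q.1 q.2| <= Mk) ->
  Y y -> `|bellman a b V y| <= a * Mk + b * M.
Proof.
move=> a0 b0 lV VM kM Yy.
have [|sigma [_ Us bE _]] := @bellman_selector a b V b0 lV; first by exists M.
by rewrite bE//; apply: objective_bounded => //; split => //; exact: Us.
Qed.

Lemma bellman_le a b V1 V2 y : 0 <= b -> lsc_on Y V1 -> bounded_on Y V1 ->
  lsc_on Y V2 -> bounded_on Y V2 -> (forall y, Y y -> V1 y <= V2 y) -> Y y ->
  bellman a b V1 y <= bellman a b V2 y.
Proof.
move=> b0 l1 b1 l2 b2 le12 Yy.
have [s1 [_ _ _ h1]] := @bellman_selector a b V1 b0 l1 b1.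
have [s2 [_ U2 h2 _]] := @bellman_selector a b V2 b0 l2 b2.
rewrite h2//; apply: le_trans (h1 _ _ Yy (U2 _ Yy)) _.
rewrite /objective lerD2l ler_wpM2l//; apply: next_le => //.
by split => //; exact: U2.
Qed.

(* Knaster-Tarski: the fixpoint is the largest subsolution, which is lower
   semicontinuous as a supremum of lower semicontinuous functions. *)
Lemma bellman_fixpoint eps : 0 < eps < 1 -> exists V, [/\ lsc_on Y V,
  bounded_on Y V & forall y, Y y -> V y = bellman eps (1 - eps) V y].
Proof.
move=> /andP[e0 e1]; have [Mk Mk0 kM] := cost_bounded.
have e1' : 0 <= 1 - eps by lra.
(* The weights sum to 1, so the operator preserves the bound [Mk]. *)
have eM : eps * Mk + (1 - eps) * Mk = Mk by ring.
pose Zs := [set Z : 'rV[R]_n -> R | [/\ lsc_on Y Z, forall y, Y y -> `|Z y| <= Mk &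
  forall y, Y y -> Z y <= bellman eps (1 - eps) Z y]].
have bZ Z : Zs Z -> bounded_on Y Z by move=> [_ h _]; exists Mk.
have TM Z y : Zs Z -> Y y -> `|bellman eps (1 - eps) Z y| <= Mk.
  move=> [lZ ZM _] Yy; have := bellman_bounded (ltW e0) e1' lZ ZM kM Yy.
  by rewrite eM.
have lcst : lsc_on Y (fun=> - Mk).
  by apply: within_lsc_on => //; apply: continuous_subspaceT; exact: cst_continuous.
have Z0 : Zs (fun=> - Mk).
  split => //; first by move=> y _; rewrite normrN ger0_norm.
  move=> y Yy; have cM y' : Y y' -> `|- Mk| <= Mk by rewrite normrN ger0_norm.
  have := bellman_bounded (ltW e0) e1' lcst cM kM Yy.
  by rewrite eM ler_norml => /andP[].
pose V y := sup [set Z y | Z in Zs].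
have hs y : Y y -> has_sup [set Z y | Z in Zs].
  move=> Yy; split; first by exists (- Mk), (fun=> - Mk).
  by exists Mk => _ [Z [_ ZM _] <-]; apply: le_trans (ler_norm _) (ZM _ Yy).
have ZV Z y : Zs Z -> Y y -> Z y <= V y.
  by move=> ZZ Yy; apply: ub_le_sup; [exact: (hs y Yy).2|exists Z].
have Vle y c : Y y -> (forall Z, Zs Z -> Z y <= c) -> V y <= c.
  move=> Yy h; apply: ge_sup; first exact: (hs y Yy).1.
  by move=> _ [Z ZZ <-]; exact: h.
have lV : lsc_on Y V.
  apply: (@lsc_on_sup _ _ _ _ Zs (fun Z => Z)) => //; first by move=> Z [].
  move=> y Yy c; split=> [h Z ZZ|]; last exact: Vle.
  by apply: le_trans h; exact: ZV.
have VM y : Y y -> `|V y| <= Mk.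
  move=> Yy; rewrite ler_norml (ZV _ _ Z0 Yy)/=; apply: Vle => // Z [_ ZM _].
  by apply: le_trans (ler_norm _) (ZM _ Yy).
have bV : bounded_on Y V by exists Mk.
have VT y : Y y -> V y <= bellman eps (1 - eps) V y.
  move=> Yy; apply: Vle => // Z ZZ; have [lZ ZM ZT] := ZZ.
  apply: le_trans (ZT _ Yy) _; apply: bellman_le => //; first exact: bZ.
  by move=> y' Yy'; exact: ZV.
exists V; split => // y Yy; apply/eqP; rewrite eq_le VT//=.
(* By monotonicity the image of a subsolution is again a subsolution, so the image of the largest
   one lies below it. *)
apply: ZV => //; split.
- exact: bellman_lsc.
- move=> y' Yy'; have := bellman_bounded (ltW e0) e1' lV VM kM Yy'.
  by rewrite eM.
- move=> y' Yy'; apply: bellman_le => //; first exact: bellman_lsc.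
  exists (eps * Mk + (1 - eps) * Mk) => z Yz; apply: bellman_bounded => //.
  exact: ltW.
Qed.

Local Notation GB := (G : set (borel ('rV[R]_n * Uh)%type)).

Lemma graph_state_bmf (V : 'rV[R]_n -> R) : lsc_on Y V -> bounded_on Y V ->
  bmf GB (fun p => V p.1).
Proof.
move=> lV [M VM]; apply: lsc_on_bmf; last by exists M => p [/VM].
move=> c; rewrite (_ : _ `&` _ =
  G `&` (fst @^-1` (Y `&` [set y | V y <= c]))).
  apply: closedI; first exact: graph_closed.
  by apply: preimage_closed; [move=> x _; exact: cvg_fst|exact: lV].
by apply/seteqP; split=> p; [move=> [[]]|move=> [Gp []]].
Qed.

Lemma cost_bmf : bmf GB (fun p => k p.1 p.2).
Proof.
apply: lsc_on_bmf; last by have [M _ kM] := cost_bounded; exists M.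
by apply: seq_continuous_lsc_on; [exact: graph_closed|exact: seq_continuous_cost].
Qed.

Lemma graph_next_bmf (V : 'rV[R]_n -> R) : lsc_on Y V -> bounded_on Y V ->
  bmf GB (next V).
Proof.
move=> lV bV; have [M VM] := bV; apply: lsc_on_bmf.
  have := @objective_lsc 0 1 V ler01 lV bV.
  rewrite (_ : objective 0 1 V = next V)//.
  by apply/funext => p; rewrite /objective mul0r add0r mul1r.
by exists M => p; exact: next_bounded.
Qed.


(** * The filtration generated by the noise *)

Definition index_below (t : nat) : {fset nat} := [fset i in iota 0 t]%fset.

(** Cylinders constrained only at times before [t]. They form a pi-system, so independence checked
    on them extends to the sigma-algebra of the past. *)
Definition past_rectangles (t : nat) : set (set Omega) :=
  [set A | exists2 B : nat -> set (borel S), (forall i, measurable (B i)) &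
    A = \bigcap_(i in [set` index_below t]) (s i @^-1` B i)].

Definition past_type (t : nat) := g_sigma_algebraType (past_rectangles t).

Let in_index_below i t : (i \in index_below t) = (i < t)%N.
Proof. by rewrite /index_below !inE/= mem_iota. Qed.

Let s_preimage_measurable t (B : set (borel S)) :
  measurable B -> measurable (s t @^-1` B).
Proof. by move=> mB; rewrite -[X in measurable X]setTI; exact: s_measurable. Qed.

Let rectangle_measurable t (A : set Omega) : past_rectangles t A -> measurable A.
Proof.
move=> [B mB ->]; apply: fin_bigcap_measurable; first exact: finite_fset.
by move=> i _; exact: s_preimage_measurable.
Qed.

Lemma past_measurable t (A : set Omega) : @measurable _ (past_type t) A -> measurable A.
Proof.
suff : <<s past_rectangles t >> `<=` (measurable : set (set Omega)) by exact.
apply: smallest_sub; last by move=> B; exact: rectangle_measurable.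
split => //; [by move=> B mB; rewrite setTD; exact: measurableC |
              by move=> u_ mu_; exact: bigcupT_measurable].
Qed.

Lemma past_s_measurable t (B : set (borel S)) :
  measurable B -> @measurable _ (past_type t.+1) (s t @^-1` B).
Proof.
move=> mB; apply: sub_sigma_algebra.
exists (fun i => if i == t then B else setT).
  by move=> i; case: ifP => // _; exact: measurableT.
apply/seteqP; split=> w; last first.
  by move=> /(_ t); rewrite /= in_index_below ltnSn eqxx; exact.
by move=> Bw i _ /=; case: eqP => // ->.
Qed.

Lemma past_mono t (A : set Omega) : @measurable _ (past_type t) A -> @measurable _ (past_type t.+1) A.
Proof.
suff : <<s past_rectangles t >> `<=` (@measurable _ (past_type t.+1)) by exact.
apply: smallest_sub.
  split => //; [by move=> B mB; rewrite setTD; exact: measurableC |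
                by move=> u_ mu_; exact: bigcupT_measurable].
move=> _ [B mB ->]; apply: sub_sigma_algebra.
exists (fun i => if i == t then setT else B i).
  by move=> i; case: ifP => // _; exact: measurableT.
apply/seteqP; split=> w h i /=; rewrite in_index_below => it.
  case: eqP => // /eqP ne; apply: h => /=.
  by rewrite in_index_below ltn_neqAle ne -ltnS.
have := h i; rewrite /= in_index_below ltnW//.
by rewrite ltn_eqF//; exact.
Qed.

(** For fixed [B] both sides are finite measures in [A]. They agree on rectangles, where the factor
    for time [t] splits off the product in [iid]. *)
Lemma past_indep t (A : set Omega) (B : set (borel S)) :
  @measurable _ (past_type t) A -> measurable B ->
  P (A `&` s t @^-1` B) = (P A * P (s 0%N @^-1` B))%E.
Proof.
move=> pA mB; have [_ s_id s_ind] := s_iid.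
have mSB := s_preimage_measurable t mB.
rewrite -(s_id t)//.
have pB_ge0 : 0 <= fine (P (s t @^-1` B)) by exact: fine_ge0.
pose m1 := mrestr P mSB; pose m2 := mscale (NngNum pB_ge0) P.
suff : m1 A = m2 A.
  by rewrite /m1 /m2 /mrestr /mscale/= fineK ?fin_num_measure// muleC.
apply: (@g_sigma_algebra_measure_unique _ R Omega (past_rectangles t) _ (fun=> setT)) => //.
- exact: rectangle_measurable.
- move=> _; exists (fun=> setT); first by move=> _; exact: measurableT.
  by apply/seteqP; split => // w _ i _.
- by rewrite bigcup_const.
- move=> _ _ [B1 mB1 ->] [B2 mB2 ->]; exists (fun i => B1 i `&` B2 i).
    by move=> i; exact: measurableI.
  by rewrite -bigcapI; apply: eq_bigcapr => i _; rewrite preimage_setI.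
- move=> _ [C mC ->]; pose CI := \bigcap_(i in [set` index_below t]) (s i @^-1` C i).
  suff : P (CI `&` s t @^-1` B) = (P (s t @^-1` B) * P CI)%E.
    by rewrite /CI /= /mrestr /mscale/= fineK ?fin_num_measure.
  pose C' i := if i == t then B else C i.
  have C't i : i \in index_below t -> C' i = C i.
    by rewrite in_index_below /C' => /ltn_eqF ->.
  have mC' i : measurable (C' i) by rewrite /C'; case: ifP.
  have := s_ind (t |` index_below t)%fset C' mC'.
  rewrite big_fsetU1/=; last by rewrite in_index_below ltnn.
  rewrite {2}/C' eqxx => e.
  transitivity (P (\bigcap_(i in [set` (t |` index_below t)%fset]) (s i @^-1` C' i))).
    congr (P _); apply/seteqP; split=> w.
      move=> [Cw Bw] i /=; rewrite in_fset1U => /orP[/eqP ->|it].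
        by rewrite /C' eqxx.
      by rewrite C't//; exact: (Cw i it).
    move=> h; split.
      by move=> i /= it; rewrite -C't//; apply: h; rewrite /= in_fset1U it orbT.
    by have := h t; rewrite /C' eqxx; apply; rewrite /= in_fset1U eqxx.
  rewrite e; congr (_ * _)%E; rewrite s_ind//; apply: eq_big_seq => i it.
  by rewrite C't.
- move=> _; apply: (@le_lt_trans _ _ (P (setT `&` s t @^-1` B))) => //.
  by rewrite setTI ltey_eq fin_num_measure.
Qed.


Lemma past_bmf t (D : set Omega) (g : Omega -> R) : @measurable _ (past_type t) D ->
  @bmf _ (past_type t) R D g -> bmf D g.
Proof.
move=> mD [mg gM]; split; last exact: gM.
move=> _ B mB; exact: (past_measurable (mg mD B mB)).
Qed.

(* f is not assumed jointly measurable, so F is approximated by functions with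
   finitely many values, for which independence applies value by value. *)
Section noise.
Context (phi : 'rV[R]_n -> R) (t : nat) (cphi : {within Y, continuous phi}).

Let lphi : lsc_on Y phi := within_lsc_on Y_closed cphi.
Let bphi : bounded_on Y phi := within_bounded_on Y_compact Y_closed cphi.

Let after p w := phi (f p.1 p.2 (s t w)).

Let after_bmf p : G p -> @bmf _ (past_type t.+1) R setT (after p).
Proof.
move=> Gp; have [_ [mg [M gM]]] := next_bmf 0 lphi bphi Gp.
split; last by exists M => w _; exact: gM.
apply: (@measurableT_comp _ _ _ (past_type t.+1) (borel S) R
  (fun z => phi (f p.1 p.2 z))) => // _ B mB.
by rewrite setTI; exact: past_s_measurable.
Qed.

Let int_after p (A : set Omega) : G p -> @measurable _ (past_type t) A ->
  \int[P]_(w in A) after p w = \int[P]_(w in A) next phi p.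
Proof.
move=> Gp pA; have mA := past_measurable pA.
have [_ bg] := next_bmf 0 lphi bphi Gp.
rewrite Rintegral_cst; last exact: mA.
rewrite /Enext ExE mulrC.
exact: (@indep_integral R _ _ Omega (borel S) P A (s t) (s 0%N)
  (fun z => phi (f p.1 p.2 z)) mA (s_measurable t) (s_measurable 0)
  (fun B mB => past_indep pA mB) bg).
Qed.

Context (F : Omega -> 'rV[R]_n * Uh) (FG : forall w, G (F w)).
Context (mF : @measurable_fun _ _ (past_type t) (borel ('rV[R]_n * Uh)%type) setT F).

(** [Z] takes the first point of [l] whose cell contains [F w], and the default [p0] where there is
    none. [A] is kept general because the induction continues on the part of [A] outside the first
    cell. *)
Let simple_approx (N : 'rV[R]_n * Uh -> set ('rV[R]_n * Uh)) p0 : G p0 ->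
    (forall p, open (N p)) ->
  forall l : seq ('rV[R]_n * Uh), (forall p, p \in l -> G p) ->
  forall A : set Omega, @measurable _ (past_type t) A ->
  exists Z : Omega -> 'rV[R]_n * Uh,
    [/\ forall w, G (Z w),
       forall w, A w -> (exists2 p, p \in l & N p (F w)) -> N (Z w) (F w),
       @bmf _ (past_type t.+1) R A (fun w => after (Z w) w),
       @bmf _ (past_type t) R A (fun w => next phi (Z w)) &
       \int[P]_(w in A) after (Z w) w = \int[P]_(w in A) next phi (Z w)].
Proof.
move=> Gp0 oN; elim=> [_ A pA|p l ih lG A pA].
  exists (fun=> p0); split => //.
  - by move=> w _ [p]; rewrite in_nil.
  - by apply: bmfS (after_bmf Gp0) => //; exact: measurableT.
  - exact: bmf_cst.
  - exact: int_after.
have Gp : G p by apply: lG; rewrite mem_head.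
pose B := F @^-1` N p.
have pB : @measurable _ (past_type t) B.
  by rewrite -[B]setTI; apply: mF => //; apply: sub_sigma_algebra; exact: oN.
have pA1 : @measurable _ (past_type t) (A `&` B) by exact: measurableI.
have pA2 : @measurable _ (past_type t) (A `\` B) by exact: measurableD.
have [|Z [ZG ZN b1 b2 e]] := ih _ (A `\` B) pA2.
  by move=> q ql; apply: lG; rewrite inE ql orbT.
pose Z' w := if `[< B w >] then p else Z w.
have Z'1 w : (A `&` B) w -> Z' w = p by move=> [_ Bw]; rewrite /Z' asboolT.
have Z'2 w : (A `\` B) w -> Z' w = Z w by move=> [_ Bw]; rewrite /Z' asboolF.
have AE : A = (A `&` B) `|` (A `\` B).
  apply/seteqP; split=> w; last by move=> [[]|[]].
  by move=> Aw; have [Bw|nBw] := pselect (B w); [left|right].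
have mA1 := past_measurable pA1; have mA2 := past_measurable pA2.
have disj : [disjoint A `&` B & A `\` B].
  by apply/disj_setPS => w [[_ Bw] [_ nBw]].
have ba1 : @bmf _ (past_type t.+1) R (A `&` B) (fun w => after (Z' w) w).
  apply: (@eq_bmf _ (past_type t.+1) R _ (after p)).
    by move=> w; rewrite inE => /Z'1 ->.
  by apply: bmfS (after_bmf Gp) => //; exact: measurableT.
have ba2 : @bmf _ (past_type t.+1) R (A `\` B) (fun w => after (Z' w) w).
  apply: (@eq_bmf _ (past_type t.+1) R _ (fun w => after (Z w) w)) => //.
  by move=> w; rewrite inE => /Z'2 ->.
have ba : @bmf _ (past_type t.+1) R A (fun w => after (Z' w) w).
  by rewrite AE; apply: bmfU => //; exact: past_mono.
have bn1 : @bmf _ (past_type t) R (A `&` B) (fun w => next phi (Z' w)).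
  apply: (@eq_bmf _ (past_type t) R _ (fun=> next phi p)).
    by move=> w; rewrite inE => /Z'1 ->.
  exact: bmf_cst.
have bn2 : @bmf _ (past_type t) R (A `\` B) (fun w => next phi (Z' w)).
  apply: (@eq_bmf _ (past_type t) R _ (fun w => next phi (Z w))) => //.
  by move=> w; rewrite inE => /Z'2 ->.
have bn : @bmf _ (past_type t) R A (fun w => next phi (Z' w)).
  by rewrite AE; apply: bmfU.
exists Z'; split => //.
- by move=> w; rewrite /Z'; case: asboolP.
- move=> w Aw [q ql Nq]; rewrite /Z'; case: asboolP => // nBw.
  apply: ZN; first by split.
  exists q => //; move: ql; rewrite inE => /predU1P[qp|//].
  by exfalso; apply: nBw; rewrite /B /= -qp.
- have mA := past_measurable pA.
  have i1 := bmf_integrable P mA (past_bmf (past_mono pA) ba).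
  have i2 := bmf_integrable P mA (past_bmf pA bn).
  have splitA g : P.-integrable A (EFin \o g) -> \int[P]_(w in A) g w =
      \int[P]_(w in A `&` B) g w + \int[P]_(w in A `\` B) g w.
    by move=> ig; rewrite [in LHS]AE Rintegral_setU// -AE.
  rewrite (splitA _ i1) (splitA _ i2); congr (_ + _).
    transitivity (\int[P]_(w in A `&` B) after p w).
      by apply: eq_Rintegral => w; rewrite inE => /Z'1 ->.
    rewrite int_after//; apply: eq_Rintegral => w.
    by rewrite inE => /Z'1 ->.
  transitivity (\int[P]_(w in A `\` B) after (Z w) w).
    by apply: eq_Rintegral => w; rewrite inE => /Z'2 ->.
  by rewrite e; apply: eq_Rintegral => w; rewrite inE => /Z'2 ->.
Qed.

Let approx : exists Z : nat -> Omega -> 'rV[R]_n * Uh,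
  [/\ forall j w, G (Z j w), forall w, Z j w @[j --> \oo] --> F w,
     forall j, @bmf _ (past_type t.+1) R setT (fun w => after (Z j w) w),
     forall j, @bmf _ (past_type t) R setT (fun w => next phi (Z j w)) &
     forall j, \int[P]_w after (Z j w) w = \int[P]_w next phi (Z j w)].
Proof.
have [y0 Yy0] := Y_nonempty; have [u0 Gy0] := G_ex Yy0.
have /choice[Z ZP] : forall j : nat, exists Z : Omega -> 'rV[R]_n * Uh,
    [/\ forall w, G (Z w), forall w, ball (Z w) (j.+1%:R^-1 : R) (F w),
       @bmf _ (past_type t.+1) R setT (fun w => after (Z w) w),
       @bmf _ (past_type t) R setT (fun w => next phi (Z w)) &
       \int[P]_w after (Z w) w = \int[P]_w next phi (Z w)].
  move=> j; pose N (p : 'rV[R]_n * Uh) := (ball p (j.+1%:R^-1 : R))°.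
  have [|l [lG lN]] := compact_subcover (N := N) graph_compact.
    by move=> p _; apply: nbhs_interior; apply: nbhsx_ballx; rewrite invr_gt0.
  have [|Z [ZG ZN b1 b2 e]] := simple_approx Gy0 (N := N) _ lG (@measurableT _ _).
    by move=> p; exact: open_interior.
  exists Z; split => // w; have := ZN w I (lN _ (FG w)).
  exact: interior_subset.
exists Z; split=> [j w|w|j|j|j]; try by have [] := ZP j.
apply/cvg_ballP => e e0; near=> j; have [_ /(_ w) + _ _ _] := ZP j.
move=> /ball_sym; apply: le_ball; apply: ltW; near: j.
exact: near_infty_natSinv_lt (PosNum e0).
Unshelve. all: by end_near. Qed.

(** The measurability half feeds the induction on time that makes the trajectory adapted; the
    integral half is the Markov property for continuous [phi]. Both pass to the limit along the
    rounded versions of [F]. *)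
Lemma noise_step :
  @measurable_fun _ _ (past_type t.+1) R setT
    (fun w => phi (f (F w).1 (F w).2 (s t w))) /\
  \int[P]_w phi (f (F w).1 (F w).2 (s t w)) = \int[P]_w next phi (F w).
Proof.
have [Z [ZG ZF b1 b2 e]] := approx.
have [M phiM] := bphi.
have c1 w : after (Z j w) w @[j --> \oo] --> after (F w) w.
  exact: (@seq_continuous_after phi (s t w) cphi _ _ (fun j => ZG j w) (FG w) (ZF w)).
have c2 w : next phi (Z j w) @[j --> \oo] --> next phi (F w).
  exact: (@seq_continuous_next phi cphi _ _ (fun j => ZG j w) (FG w) (ZF w)).
split.
  by apply: (@measurable_fun_cvg _ (past_type t.+1) R setT
    (fun j w => after (Z j w) w)) => // j; have [] := b1 j.
have pT i : @measurable _ (past_type i) setT by exact: measurableT.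
have [//|||_ i1] := @bounded_cvg _ Omega R P setT (fun j w => after (Z j w) w)
  (fun w => after (F w) w) M measurableT.
- by move=> j; have [] := past_bmf (pT _) (b1 j).
- by move=> j w _; apply: phiM; case: (ZG j w) => *; exact: f_invariant.
- by move=> w _; exact: c1.
have [//|||_ i2] := @bounded_cvg _ Omega R P setT (fun j w => next phi (Z j w))
  (fun w => next phi (F w)) M measurableT.
- by move=> j; have [] := past_bmf (pT _) (b2 j).
- by move=> j w _; exact: next_bounded.
- by move=> w _; exact: c2.
have E : (fun j => \int[P]_w after (Z j w) w) =
    (fun j => \int[P]_w next phi (Z j w)) by apply/funext.
have i1' : (fun j => \int[P]_w next phi (Z j w)) @ \oo --> \int[P]_w after (F w) w.
  by rewrite -E.
exact: (cvg_unique (@Rhausdorff R) i1' i2).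
Qed.

End noise.


(** * Trajectories *)

Section trajectory.
Context (pi : nat -> 'rV[R]_n -> Uh) (pi_plan : plans Y U pi).
Context (y0 : 'rV[R]_n) (Yy0 : Y y0).

Implicit Types (g : 'rV[R]_n * Uh -> R) (V : 'rV[R]_n -> R).

Definition trajectory (t : nat) (w : Omega) : 'rV[R]_n * Uh :=
  (state s f pi y0 t w, control s f pi y0 t w).

Let state_in t w : Y (state s f pi y0 t w).
Proof.
by elim: t => [//|t ih] /=; apply: f_invariant => //; apply: (pi_plan t).2.
Qed.

Lemma trajectory_graph t w : G (trajectory t w).
Proof. by split; [exact: state_in|exact: ((pi_plan t).2 _ (state_in t w))]. Qed.

Let trajectory_past_of_state t :
  @measurable_fun _ _ (past_type t) (borel 'rV[R]_n) setT (state s f pi y0 t) ->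
  @measurable_fun _ _ (past_type t) (borel ('rV[R]_n * Uh)%type) setT (trajectory t).
Proof.
move=> my.
apply: (@compact_valued_measurable R ('rV[R]_n * Uh)%type G _ (past_type t)).
- exact: graph_compact.
- exact: trajectory_graph.
move=> [a b] e e0.
exists [set p | (ball a e)° p.1 /\ (ball b e)° p.2]; split.
- exists ((ball a e)°, (ball b e)°) => //=.
  by split; apply: nbhs_interior; exact: nbhsx_ballx.
- by move=> [a' b'] [/interior_subset ? /interior_subset ?].
have mY : measurable (Y : set (borel 'rV[R]_n)) by exact: closed_borel.
have mb : measurable ((ball b e)° : set (borel Uh)).
  by apply: sub_sigma_algebra; exact: open_interior.
(* [pi t] is Borel on [Y] only, so [Y], where the state always lies, is inserted. *)
rewrite (_ : _ @^-1` _ = state s f pi y0 t @^-1` (ball a e)° `&`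
    state s f pi y0 t @^-1` (Y `&` pi t @^-1` (ball b e)°)); last first.
  apply/seteqP; split=> w; first by move=> [h1 h2]; split => //; split.
  by move=> [h1 [_ h2]].
apply: measurableI.
  by have := my measurableT _ (sub_sigma_algebra (open_interior (ball a e)));
     rewrite setTI; exact.
by have := my measurableT _ ((pi_plan t).1 mY _ mb); rewrite setTI; exact.
Qed.

(** Distances to fixed points are continuous test functions whose sublevel sets are balls;
    [noise_step] applied to them makes the next state adapted. *)
Lemma trajectory_past t :
  @measurable_fun _ _ (past_type t) (borel ('rV[R]_n * Uh)%type) setT (trajectory t).
Proof.
elim: t => [|t ih]; apply: trajectory_past_of_state.
  exact: measurable_cst.
apply: (@compact_valued_measurable R 'rV[R]_n Y _ (past_type t.+1)) => //.
move=> x e e0; exists (ball x e); split => //; first exact: nbhsx_ballx.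
have cphi : {within Y, continuous (fun y => `|x - y|)}.
  by apply: continuous_subspaceT; exact: norm_sub_continuous.
have [mphi _] := noise_step cphi (trajectory_graph t) ih.
have := mphi measurableT _ (@measurable_itv R `]-oo, e[).
by rewrite setTI preimage_itvNyo -ball_normE.
Qed.

Lemma trajectory_measurable t :
  @measurable_fun _ _ Omega (borel ('rV[R]_n * Uh)%type) setT (trajectory t).
Proof.
move=> _ B mB; apply: (@past_measurable t).
exact: (@trajectory_past t measurableT B mB).
Qed.

Lemma trajectory_bmf g t : bmf GB g ->
  bmf [set: Omega] (fun w => g (trajectory t w)).
Proof.
move=> [mg [M gM]]; split; last by exists M => w _; apply: gM; exact: trajectory_graph.
apply: (measurable_comp (F := GB)) => //.
- exact: graph_measurable.
- by move=> _ [w _ <-]; exact: trajectory_graph.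
- exact: trajectory_measurable.
Qed.

Lemma trajectory_state_bmf V t : lsc_on Y V -> bounded_on Y V ->
  bmf [set: Omega] (fun w => V (state s f pi y0 t w)).
Proof. by move=> lV bV; apply: (trajectory_bmf (g := fun p => V p.1)); exact: graph_state_bmf. Qed.

(** The Markov property for functions as irregular as the value functions: the approximants of
    [lsc_approx] carry it over from continuous ones. *)
Lemma expected_next V t : lsc_on Y V -> bounded_on Y V ->
  \int[P]_w V (state s f pi y0 t.+1 w) = \int[P]_w next V (trajectory t w).
Proof.
move=> lV [M VM].
have [psi [cpsi psiM psiV psi_cvg]] := lsc_approx Y_nonempty lV VM.
have wpsi j : {within Y, continuous (psi j)} by exact: continuous_subspaceT.
have lpsi j : lsc_on Y (psi j) by exact: within_lsc_on.
have bpsi j : bounded_on Y (psi j) by exists M => y; exact: psiM.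
have E : (fun j => \int[P]_w psi j (state s f pi y0 t.+1 w)) =
    (fun j => \int[P]_w next (psi j) (trajectory t w)).
  apply/funext => j.
  by have [_] := noise_step (wpsi j) (trajectory_graph t) (@trajectory_past t).
have [//|||_ i1] := @bounded_cvg _ Omega R P setT
  (fun j w => psi j (state s f pi y0 t.+1 w))
  (fun w => V (state s f pi y0 t.+1 w)) M measurableT.
- by move=> j; have [] := trajectory_state_bmf t.+1 (lpsi j) (bpsi j).
- by move=> j w _; apply: psiM; exact: state_in.
- by move=> w _; apply: psi_cvg; exact: state_in.
have [//|||_ i2] := @bounded_cvg _ Omega R P setT
  (fun j w => next (psi j) (trajectory t w))
  (fun w => next V (trajectory t w)) M measurableT.
- by move=> j; have [] := trajectory_bmf t (graph_next_bmf (lpsi j) (bpsi j)).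
- by move=> j w _; apply: next_bounded => //; [exact: psiM|exact: trajectory_graph].
- by move=> w _; apply: (next_cvg (M := M)) => //; exact: trajectory_graph.
have i1' : (fun j => \int[P]_w next (psi j) (trajectory t w)) @ \oo -->
    \int[P]_w V (state s f pi y0 t.+1 w) by rewrite -E.
exact: (cvg_unique (@Rhausdorff R) i1' i2).
Qed.

End trajectory.


(** * Occupation measures and the balance constraints *)

Lemma occupation_measure pi y0 (c : nat -> R) : plans Y U pi -> Y y0 ->
  (forall t, 0 <= c t) -> series c @ \oo --> (1 : R) ->
  exists gam : probability (borel ('rV[R]_n * Uh)%type) R,
    gam GB = 1%E /\ forall g, bmf GB g ->
    series (fun t => c t * \int[P]_w g (trajectory pi y0 t w)) @ \oo -->
      \int[gam]_(p in GB) g p.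
Proof.
move=> pip Yy0 c0 c1.
exact: (integral_mixture P (trajectory_measurable pip Yy0) c0 c1 graph_measurable
  (trajectory_graph pip Yy0)).
Qed.

(* The integrand in the definition of W_disc; eps = 0 gives that of W_lim. *)
Definition balance (eps : R) (y0 : 'rV[R]_n) (V : 'rV[R]_n -> R) p : R :=
  (1 - eps) * (next V p - V p.1) + eps * (V y0 - V p.1).

Lemma balance_bmf eps y0 V : lsc_on Y V -> bounded_on Y V ->
  bmf GB (balance eps y0 V).
Proof.
move=> lV bV; apply: bmfD; apply: bmfZ; apply: bmfB.
- exact: graph_next_bmf.
- exact: graph_state_bmf.
- exact: bmf_cst.
- exact: graph_state_bmf.
Qed.

Lemma balance_cvg eps y0 (psi : nat -> 'rV[R]_n -> R) V M p :
  (forall j, lsc_on Y (psi j)) -> (forall j y, Y y -> `|psi j y| <= M) ->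
  (forall y, Y y -> psi j y @[j --> \oo] --> V y) -> Y y0 -> G p ->
  balance eps y0 (psi j) p @[j --> \oo] --> balance eps y0 V p.
Proof.
move=> lpsi psiM psiV Yy0 Gp; have Yp : Y p.1 by case: Gp.
apply: cvgD; apply: cvgMl_tmp; apply: cvgB; try exact: psiV.
exact: (next_cvg (M := M)).
Qed.

Lemma W_disc_balance eps y0 gam V : Y y0 -> W_disc P s Y U f eps y0 gam ->
  lsc_on Y V -> bounded_on Y V -> \int[gam]_(p in GB) balance eps y0 V p = 0.
Proof.
move=> Yy0 [_ gamW] lV [M VM].
have [psi [cpsi psiM psiV psi_cvg]] := lsc_approx Y_nonempty lV VM.
have wpsi j : {within Y, continuous (psi j)} by exact: continuous_subspaceT.
have lpsi j : lsc_on Y (psi j) by exact: within_lsc_on.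
have bpsi j : bounded_on Y (psi j) by exists M => y; exact: psiM.
have [|||_ i1] := @bounded_cvg _ _ R gam GB (fun j => balance eps y0 (psi j))
  (balance eps y0 V) (`|1 - eps| * (M + M) + `|eps| * (M + M)) graph_measurable.
- by move=> j; have [] := balance_bmf eps y0 (lpsi j) (bpsi j).
- move=> j p Gp; have Yp : Y p.1 by case: Gp.
  have bB (a b : R) : `|a| <= M -> `|b| <= M -> `|a - b| <= M + M.
    by move=> aM bM; apply: le_trans (ler_normB _ _) _; exact: lerD.
  apply: le_trans (ler_normD _ _) _; rewrite !normrM; apply: lerD;
    apply: ler_wpM2l => //; apply: bB; try exact: psiM.
  by apply: next_bounded => //; exact: psiM.
- by move=> p Gp; exact: (balance_cvg (M := M)).
have E : (fun j => \int[gam]_(p in GB) balance eps y0 (psi j) p) = fun=> 0.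
  by apply/funext => j; exact: gamW.
move: i1; rewrite E => i1.
exact: (cvg_unique (@Rhausdorff R) i1 (cvg_cst _)).
Qed.

Lemma W_lim_W_disc gam y0 : W_lim P s Y U f gam <-> W_disc P s Y U f 0 y0 gam.
Proof.
split=> -[g1 h]; split=> // phi cphi; apply: etrans (h phi cphi);
  by apply: eq_Rintegral => p _; rewrite subr0 mul1r mul0r addr0.
Qed.

Lemma W_lim_next gam V : W_lim P s Y U f gam -> lsc_on Y V -> bounded_on Y V ->
  \int[gam]_(p in GB) next V p = \int[gam]_(p in GB) V p.1.
Proof.
have [y0 Yy0] := Y_nonempty.
move=> /(W_lim_W_disc _ y0) gamW lV bV; have := W_disc_balance Yy0 gamW lV bV.
have mG := graph_measurable.
have i1 := bmf_integrable gam mG (graph_next_bmf lV bV).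
have i2 := bmf_integrable gam mG (graph_state_bmf lV bV).
under eq_Rintegral do rewrite /balance subr0 mul1r mul0r addr0.
by rewrite RintegralB// => /eqP; rewrite subr_eq0 => /eqP.
Qed.

(** * Discounted problem *)

Section discounted.
Context (eps : R) (eps01 : 0 < eps < 1) (V : 'rV[R]_n -> R).
Context (lV : lsc_on Y V) (bV : bounded_on Y V)
  (fixV : forall y, Y y -> V y = bellman eps (1 - eps) V y).

Let e0 : 0 < eps. Proof. by case/andP: eps01. Qed.
Let e1 : 0 < 1 - eps. Proof. by case/andP: eps01; rewrite subr_gt0. Qed.

(** Slack in the Bellman inequality, as [gapE] shows, written so that against [W_disc] the balance
    integrates to 0 and only cost minus value remains. *)
Let gap y0 p := eps * (k p.1 p.2 - V y0) + balance eps y0 V p.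

Let gap_bmf y0 : bmf GB (gap y0).
Proof.
apply: bmfD; last exact: balance_bmf.
by apply: bmfZ; apply: bmfB; [exact: cost_bmf|exact: bmf_cst].
Qed.

Let gapE y0 p : gap y0 p = objective eps (1 - eps) V p - V p.1.
Proof. by rewrite /gap /balance /objective; ring. Qed.

Let gap_ge0 y0 p : G p -> 0 <= gap y0 p.
Proof.
move=> [Yp Up]; rewrite gapE subr_ge0 fixV//.
have [sg [_ _ _ h]] := @bellman_selector eps (1 - eps) V (ltW e1) lV bV.
by apply: le_trans (h p.1 p.2 Yp Up) _; case: (p).
Qed.

Let int_gap y0 gam : Y y0 -> W_disc P s Y U f eps y0 gam ->
  \int[gam]_(p in GB) gap y0 p = eps * (\int[gam]_(p in GB) k p.1 p.2 - V y0).
Proof.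
move=> Yy0 gamW; have mG := graph_measurable; have [gam1 _] := gamW.
have i1 := bmf_integrable gam mG cost_bmf.
have i2 := bmf_integrable gam mG (bmf_cst GB (V y0)).
have i3 := bmf_integrable gam mG (bmfB cost_bmf (bmf_cst GB (V y0))).
have i4 := bmf_integrable gam mG (bmfZ eps (bmfB cost_bmf (bmf_cst GB (V y0)))).
have i5 := bmf_integrable gam mG (balance_bmf eps y0 lV bV).
rewrite RintegralD// (W_disc_balance Yy0 gamW)// addr0 RintegralZl//.
by rewrite RintegralB// Rintegral_cst// (congr1 fine gam1) mulr1.
Qed.

Lemma discounted_dual y0 gam : Y y0 -> W_disc P s Y U f eps y0 gam ->
  V y0 <= \int[gam]_(p in GB) k p.1 p.2.
Proof.
move=> Yy0 gamW; rewrite -subr_ge0 -(pmulr_rge0 _ e0) -int_gap//.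
by apply: Rintegral_ge0 => p; exact: gap_ge0.
Qed.

Let weight t := eps * (1 - eps) ^+ t.

Let weight_ge0 t : 0 <= weight t.
Proof. by rewrite mulr_ge0// ?exprn_ge0// ltW. Qed.

Let norm_lt1 : `|1 - eps| < 1.
Proof. by rewrite gtr0_norm// gtrBl. Qed.

Let weight_series : series weight @ \oo --> (1 : R).
Proof.
have := @cvg_geometric_series R eps (1 - eps) norm_lt1.
have -> : 1 - (1 - eps) = eps by ring.
by rewrite divff// gt_eqF.
Qed.

Section plan.
Context (pi : nat -> 'rV[R]_n -> Uh) (pi_plan : plans Y U pi).
Context (y0 : 'rV[R]_n) (Yy0 : Y y0).

Let disc_cost w := limn (series (fun t =>
  (1 - eps) ^+ t * k (state s f pi y0 t w) (control s f pi y0 t w))).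

Let disc_partial N w : R := \sum_(0 <= t < N)
  ((1 - eps) ^+ t * k (trajectory pi y0 t w).1 (trajectory pi y0 t w).2).

Let disc_partial_integral N : bmf setT (disc_partial N) /\
  \int[P]_w disc_partial N w = \sum_(0 <= t < N)
    ((1 - eps) ^+ t * \int[P]_w k (trajectory pi y0 t w).1 (trajectory pi y0 t w).2).
Proof.
exact: (bmf_sum P _ N measurableT (fun t => trajectory_bmf pi_plan Yy0 t cost_bmf)).
Qed.

Let disc_cost_cvg : \sum_(0 <= t < N)
    ((1 - eps) ^+ t * \int[P]_w k (trajectory pi y0 t w).1 (trajectory pi y0 t w).2)
    @[N --> \oo] --> Ex P disc_cost.
Proof.
have [Mk Mk0 kM] := cost_bounded.
(* [Mk / eps] is the sum of the geometric bound [Mk * (1 - eps) ^+ t]. It dominates all partial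
   sums, so expectation and series can be exchanged. *)
have [|||_ i1] := @bounded_cvg _ _ R P setT disc_partial disc_cost (Mk / eps) measurableT.
- by move=> N; have [[]] := disc_partial_integral N.
- move=> N w _; apply: le_trans (ler_norm_sum _ _ _) _.
  apply: (@le_trans _ _ (\sum_(0 <= t < N) (Mk * (1 - eps) ^+ t))).
    apply: ler_sum => t _; rewrite normrM ger0_norm ?exprn_ge0 ?(ltW e1)// mulrC.
    by rewrite ler_wpM2r ?exprn_ge0 ?(ltW e1)//; apply: kM; exact: trajectory_graph.
  rewrite -mulr_sumr ler_wpM2l// -div1r ler_pdivlMr// mulrC mulr_sumr.
  have : series weight N <= 1.
    apply: (cvg_ler_near (cvg_cst _) weight_series).
    near=> m; apply: nondecreasing_series => //; by near: m; exact: nbhs_infty_ge.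
  by [].
- move=> w _; rewrite /disc_cost.
  suff : cvgn (series (fun t => (1 - eps) ^+ t *
      k (state s f pi y0 t w) (control s f pi y0 t w))) by [].
  apply: normed_cvg; apply: (series_le_cvg (v_ := geometric Mk (1 - eps))).
  + by move=> t; exact: normr_ge0.
  + by move=> t; rewrite /geometric/= mulr_ge0// exprn_ge0// ltW.
  + move=> t; rewrite /geometric/= normrM ger0_norm ?exprn_ge0 ?(ltW e1)// mulrC.
    rewrite ler_wpM2r ?exprn_ge0 ?(ltW e1)//.
    exact: (kM _ (trajectory_graph pi_plan Yy0 t w)).
  + exact: is_cvg_geometric_series.
rewrite ExE; move: i1; rewrite (_ : (fun N => \int[P]_w disc_partial N w) = fun N =>
  \sum_(0 <= t < N) ((1 - eps) ^+ t *
    \int[P]_w k (trajectory pi y0 t w).1 (trajectory pi y0 t w).2))//.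
by apply/funext => N; have [_] := disc_partial_integral N.
Unshelve. all: by end_near. Qed.

(** The third clause is complementary slackness: its hypothesis makes the slack vanish along the
    whole trajectory, hence in the integral against the occupation measure. *)
Lemma discounted_occupation :
  exists gam : probability (borel ('rV[R]_n * Uh)%type) R,
  [/\ W_disc P s Y U f eps y0 gam, \int[gam]_(p in GB) k p.1 p.2 = eps * Ex P disc_cost &
    (forall t w, V (state s f pi y0 t w) = objective eps (1 - eps) V (trajectory pi y0 t w)) ->
    \int[gam]_(p in GB) k p.1 p.2 = V y0].
Proof.
have [gam [gam1 gamI]] := occupation_measure pi_plan Yy0 weight_ge0 weight_series.
have mG := graph_measurable.
have gamW : W_disc P s Y U f eps y0 gam.
  split=> // phi cphi.
  have lphi := within_lsc_on Y_closed cphi.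
  have [M phiM] := within_bounded_on Y_compact Y_closed cphi.
  have bphi : bounded_on Y phi by exists M.
  pose E t : R := \int[P]_w phi (state s f pi y0 t w).
  have bE t : `|E t| <= M.
    apply: (Rintegral_norm_le (mu := P) measurableT (probability_setT P)).
      exact: (trajectory_state_bmf pi_plan Yy0 t lphi bphi).
    by move=> w _; apply: phiM; case: (trajectory_graph pi_plan Yy0 t w).
  have step t : \int[P]_w balance eps y0 phi (trajectory pi y0 t w) =
      (1 - eps) * E t.+1 - E t + eps * phi y0.
    have b1 := trajectory_bmf pi_plan Yy0 t (graph_next_bmf lphi bphi).
    have b2 := trajectory_state_bmf pi_plan Yy0 t lphi bphi.
    have j1 := bmf_integrable P measurableT b1.
    have j2 := bmf_integrable P measurableT b2.
    have j3 := bmf_integrable P measurableT (bmfZ (1 - eps) b1).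
    have j4 := bmf_integrable P measurableT (bmfB (bmfZ (1 - eps) b1) b2).
    have j5 := bmf_integrable P measurableT (bmf_cst setT (eps * phi y0)).
    transitivity (\int[P]_w ((1 - eps) * next phi (trajectory pi y0 t w)
        - phi (state s f pi y0 t w) + eps * phi y0)).
      by apply: eq_Rintegral => w _; rewrite /balance /trajectory/=; ring.
    rewrite (RintegralD measurableT j4 j5) (RintegralB measurableT j3 j2).
    rewrite (RintegralZl _ measurableT j1) Rintegral_cst//.
    by rewrite (congr1 fine (probability_setT P)) mulr1 -(expected_next pi_plan Yy0).
  have := gamI _ (balance_bmf eps y0 lphi bphi).
  (* The terms telescope: each is [eps] times an increment of [(1 - eps) ^+ t * (E t - phi y0)],
     which is 0 at [t = 0]. *)
  have -> : series (fun t => weight t *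
        \int[P]_w balance eps y0 phi (trajectory pi y0 t w)) =
      fun N => eps * (1 - eps) ^+ N * (E N - phi y0).
    apply/funext; elim=> [|N ih]; rewrite /series/=.
      have -> : E 0%N = phi y0.
        by rewrite /E/= Rintegral_cst// (congr1 fine (probability_setT P)) mulr1.
      by rewrite big_geq// subrr mulr0.
    rewrite big_nat_recr//= -[X in X + _]/(series _ N) ih step /weight exprS; ring.
  move=> L; have Z : (fun N => eps * (1 - eps) ^+ N * (E N - phi y0)) @ \oo --> (0 : R).
    have h : (fun N => geometric (eps * (M + M)) (1 - eps) N) @ \oo --> (0 : R).
      exact: cvg_geometric.
    apply/norm_cvg0P; apply: (@squeeze_cvgr _ _ _ _ (fun=> 0)
      (geometric (eps * (M + M)) (1 - eps))) => //; last exact: cvg_cst.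
    near=> N; rewrite normr_ge0/= /geometric/= normrM ger0_norm; last first.
      by rewrite mulr_ge0 ?exprn_ge0// ltW.
    rewrite mulrAC ler_wpM2r ?exprn_ge0 ?(ltW e1)// ler_wpM2l ?(ltW e0)//.
    by apply: le_trans (ler_normB _ _) _; rewrite lerD// phiM.
  exact: (cvg_unique (@Rhausdorff R) L Z).
exists gam; split=> //.
  have L := gamI _ cost_bmf.
  have L' := cvgMl_tmp (a := eps) disc_cost_cvg.
  move: L; rewrite (_ : series _ = fun N => eps * \sum_(0 <= t < N)
    ((1 - eps) ^+ t * \int[P]_w k (trajectory pi y0 t w).1 (trajectory pi y0 t w).2)).
    by move=> L; exact: (cvg_unique (@Rhausdorff R) L (L' _)).
  apply/funext => N; rewrite /series/= mulr_sumr; apply: eq_bigr => t _.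
  by rewrite mulrA.
move=> tight; have L := gamI _ (gap_bmf y0).
have Z : series (fun t => weight t * \int[P]_w gap y0 (trajectory pi y0 t w)) = fun=> 0.
  apply/funext => N; rewrite /series/=; apply: big1 => t _.
  under eq_Rintegral => w _ do rewrite gapE/= -tight subrr.
  by rewrite Rintegral_cst// mul0r mulr0.
move: L; rewrite Z => L.
have L0 : (fun=> 0 : R) @ \oo --> (0 : R) by exact: cvg_cst.
have : \int[gam]_(p in GB) gap y0 p = 0 by exact: (cvg_unique (@Rhausdorff R) L L0).
by rewrite int_gap// => /eqP; rewrite mulf_eq0 gt_eqF//= subr_eq0 => /eqP.
Unshelve. all: by end_near. Qed.

End plan.

Lemma stationary_plan (sg : 'rV[R]_n -> Uh) : borel_fun Y sg ->
  (forall y, Y y -> U y (sg y)) -> plans Y U (fun=> sg).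
Proof. by move=> msg Usg t; split. Qed.

Lemma discounted_values y0 : Y y0 -> exists gam,
  [/\ W_disc P s Y U f eps y0 gam, \int[gam]_(p in GB) k p.1 p.2 = V y0,
      h P s Y U f k eps y0 = V y0 & kstar_disc P s Y U f k eps y0 = V y0].
Proof.
move=> Yy0.
have [sg [msg Usg bsg _]] := @bellman_selector eps (1 - eps) V (ltW e1) lV bV.
have sgp := stationary_plan msg Usg.
have [gam [gamW gamk gamV]] := discounted_occupation sgp Yy0.
have gV : \int[gam]_(p in GB) k p.1 p.2 = V y0.
  apply: gamV => t w; have [Yw _] := trajectory_graph sgp Yy0 t w.
  by rewrite fixV// bsg.
exists gam; split => //.
  rewrite /h; have -> : minimum [set Ex P (fun w => limn (series (fun t =>
      (1 - eps) ^+ t * k (state s f pi y0 t w) (control s f pi y0 t w))))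
      | pi in plans Y U] = eps^-1 * V y0.
    apply: minimumE.
      by exists (fun=> sg) => //; rewrite -gV gamk mulKf// gt_eqF.
    move=> _ [pi pip <-]; rewrite ler_pdivrMl//.
    have [gam' [gam'W <- _]] := discounted_occupation pip Yy0.
    exact: discounted_dual.
  by rewrite mulVKf// gt_eqF.
apply: minimumE; first by exists gam.
by move=> _ [gam' gam'W <-]; exact: discounted_dual.
Qed.

Lemma discounted_lim_dual gam m : W_lim P s Y U f gam ->
  (forall y, Y y -> m <= V y) -> m <= \int[gam]_(p in GB) k p.1 p.2.
Proof.
move=> gamW mV; have mG := graph_measurable; have [gam1 _] := gamW.
have i1 := bmf_integrable gam mG cost_bmf.
have i2 := bmf_integrable gam mG (graph_state_bmf lV bV).
have i3 := bmf_integrable gam mG (graph_next_bmf lV bV).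
have i4 := bmf_integrable gam mG (bmfZ eps cost_bmf).
have i5 := bmf_integrable gam mG (bmfZ (1 - eps) (graph_next_bmf lV bV)).
have i6 := bmf_integrable gam mG (bmf_cst GB m).
have i7 := bmf_integrable gam mG (bmfD (bmfZ eps cost_bmf)
  (bmfZ (1 - eps) (graph_next_bmf lV bV))).
have h1 : \int[gam]_(p in GB) V p.1 <= \int[gam]_(p in GB) objective eps (1 - eps) V p.
  apply: le_Rintegral => // p Gp.
  by have := gap_ge0 p.1 Gp; rewrite gapE subr_ge0.
have h2 : \int[gam]_(p in GB) m <= \int[gam]_(p in GB) V p.1.
  by apply: le_Rintegral => // p [Yp _]; exact: mV.
move: h1; rewrite RintegralD// !RintegralZl// (W_lim_next gamW)// => h1.
move: h2; rewrite Rintegral_cst// (congr1 fine gam1) mulr1 => /le_trans; apply.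
rewrite -(ler_pM2l e0); lra.
Qed.

End discounted.


(** * Finite horizon *)

Section finite_horizon.

Fixpoint cost_to_go (T : nat) : 'rV[R]_n -> R :=
  if T is T'.+1 then bellman 1 1 (cost_to_go T') else fun=> 0.

Lemma cost_to_go_lsc_bounded T : lsc_on Y (cost_to_go T) /\ bounded_on Y (cost_to_go T).
Proof.
elim: T => [|T [lT [M bT]]].
  split; last by exists 0 => y _; rewrite normr0.
  by apply: within_lsc_on => //; apply: continuous_subspaceT; exact: cst_continuous.
have [Mk _ kM] := cost_bounded; split; first by apply: bellman_lsc => //; exists M.
exists (1 * Mk + 1 * M) => y Yy; exact: bellman_bounded.
Qed.

Let ctg_lsc T := (cost_to_go_lsc_bounded T).1.
Let ctg_bounded T := (cost_to_go_lsc_bounded T).2.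

Let gap T p := objective 1 1 (cost_to_go T) p - cost_to_go T.+1 p.1.

Let gap_ge0 T p : G p -> 0 <= gap T p.
Proof.
move=> [Yp Up]; rewrite subr_ge0 /=.
have [sg [_ _ _ h]] := @bellman_selector 1 1 _ ler01 (@ctg_lsc T) (ctg_bounded T).
by apply: le_trans (h p.1 p.2 Yp Up) _; case: (p).
Qed.

Let gap_bmf T : bmf GB (gap T).
Proof.
apply: bmfB; last exact: graph_state_bmf.
apply: bmfD; apply: bmfZ; first exact: cost_bmf.
exact: graph_next_bmf.
Qed.

Section plan.
Context (pi : nat -> 'rV[R]_n -> Uh) (pi_plan : plans Y U pi).
Context (y0 : 'rV[R]_n) (Yy0 : Y y0).

Local Notation E g := (fun t => \int[P]_w g (trajectory pi y0 t w)).

Let E_next T t : E (fun p => k p.1 p.2) t +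
    \int[P]_w cost_to_go T (state s f pi y0 t.+1 w) =
  E (gap T) t + \int[P]_w cost_to_go T.+1 (state s f pi y0 t w).
Proof.
have b1 := trajectory_bmf pi_plan Yy0 t cost_bmf.
have b2 := trajectory_bmf pi_plan Yy0 t (graph_next_bmf (@ctg_lsc T) (ctg_bounded T)).
have b3 := trajectory_bmf pi_plan Yy0 t (gap_bmf T).
have b4 := trajectory_state_bmf pi_plan Yy0 t (@ctg_lsc T.+1) (ctg_bounded T.+1).
rewrite (expected_next pi_plan Yy0)//.
rewrite -(RintegralD measurableT (bmf_integrable P measurableT b1)
  (bmf_integrable P measurableT b2)).
rewrite -(RintegralD measurableT (bmf_integrable P measurableT b3)
  (bmf_integrable P measurableT b4)).
by apply: eq_Rintegral => w _; rewrite /gap /objective /trajectory/=; ring.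
Qed.

(** Any plan pays the optimal cost plus the slacks it incurs. With [j + T] steps in all, the slack
    at time [t] is indexed by the number of steps left after that one. *)
Let telescope_cost j T : \sum_(0 <= t < j) E (fun p => k p.1 p.2) t +
    \int[P]_w cost_to_go T (state s f pi y0 j w) =
  cost_to_go (j + T) y0 + \sum_(0 <= t < j) E (gap (j + T - t.+1)) t.
Proof.
elim: j T => [|j ih] T.
  by rewrite !big_geq//= Rintegral_cst// (congr1 fine (probability_setT P)) mulr1 add0r addr0.
rewrite big_nat_recr//= -addrA E_next addrCA ih addrCA big_nat_recr//=.
by rewrite addSnnS addnS subSS addnC addnK addnC [in RHS]addrC addrA.
Qed.

Lemma finite_horizon_cost T :
  Ex P (fun w => \sum_(0 <= t < T) k (state s f pi y0 t w) (control s f pi y0 t w)) =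
    \sum_(0 <= t < T) E (fun p => k p.1 p.2) t /\
  \sum_(0 <= t < T) E (fun p => k p.1 p.2) t =
    cost_to_go T y0 + \sum_(0 <= t < T) E (gap (T - t.+1)) t.
Proof.
split.
  rewrite ExE; have [_] := bmf_sum P (fun=> 1) T measurableT
    (fun t => trajectory_bmf pi_plan Yy0 t cost_bmf).
  under [X in _ = X]eq_bigr do rewrite mul1r.
  move=> <-; apply: eq_Rintegral => w _.
  by apply: eq_bigr => t _; rewrite mul1r.
have := telescope_cost T 0; rewrite addn0 /= Rintegral_cst// mul0r addr0.
by [].
Qed.

Lemma average_occupation T : (0 < T)%N ->
  exists gam : probability (borel ('rV[R]_n * Uh)%type) R,
    gam GB = 1%E /\ forall g, bmf GB g ->
    \int[gam]_(p in GB) g p = T%:R^-1 * \sum_(0 <= t < T) E g t.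
Proof.
(* Uniform weights on the first [T] times: the series is constant from [T] on, and its limit is a
   finite average. *)
move=> T0; pose c t : R := if (t < T)%N then T%:R^-1 else 0.
have eventually_cst (a : nat -> R) :
    series (fun t => c t * a t) @ \oo --> T%:R^-1 * \sum_(0 <= t < T) a t.
  apply: cvg_near_cst; near=> N.
  have TN : (T <= N)%N by near: N; exact: nbhs_infty_ge.
  rewrite /series/= (big_cat_nat _ (n := T))//= mulr_sumr.
  rewrite [X in _ + X]big1_seq ?addr0; last first.
    by move=> t; rewrite mem_index_iota => /andP[_ /andP[Tt _]]; rewrite /c ltnNge Tt mul0r.
  by apply: eq_big_nat => t /andP[_ tT]; rewrite /c tT.
have c0 t : 0 <= c t by rewrite /c; case: ifP => // _; rewrite invr_ge0.
have c1 : series c @ \oo --> (1 : R).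
  have := eventually_cst (fun=> 1).
  rewrite sumr_const_nat subn0 mulVf ?pnatr_eq0 -?lt0n//.
  by under eq_fun do rewrite mulr1.
have [gam [gam1 gamI]] := occupation_measure pi_plan Yy0 c0 c1.
exists gam; split => // g bg.
exact: (cvg_unique (@Rhausdorff R) (gamI g bg) (eventually_cst _)).
Unshelve. all: by end_near. Qed.

(** The expected increments telescope, so that averaging over [T] steps leaves two boundary terms of
    size at most [M / T]. *)
Lemma average_occupation_drift T gam phi M : (0 < T)%N ->
  (forall g, bmf GB g ->
    \int[gam]_(p in GB) g p = T%:R^-1 * \sum_(0 <= t < T) E g t) ->
  {within Y, continuous phi} -> (forall y, Y y -> `|phi y| <= M) ->
  `|\int[gam]_(p in GB) (next phi p - phi p.1)| <= M * (2 / T%:R).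
Proof.
move=> T0 gamI cphi phiM.
have lphi := within_lsc_on Y_closed cphi.
have bphi : bounded_on Y phi by exists M.
pose F t := \int[P]_w phi (state s f pi y0 t w).
have bF t : `|F t| <= M.
  apply: (Rintegral_norm_le (mu := P) measurableT (probability_setT P)).
    exact: (trajectory_state_bmf pi_plan Yy0 t lphi bphi).
  by move=> w _; apply: phiM; case: (trajectory_graph pi_plan Yy0 t w).
rewrite gamI; last by apply: bmfB; [exact: graph_next_bmf|exact: graph_state_bmf].
have step t : E (fun p => next phi p - phi p.1) t = F t.+1 - F t.
  have b1 := trajectory_bmf pi_plan Yy0 t (graph_next_bmf lphi bphi).
  have b2 := trajectory_state_bmf pi_plan Yy0 t lphi bphi.
  rewrite (RintegralB measurableT (bmf_integrable P measurableT b1)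
    (bmf_integrable P measurableT b2)).
  by rewrite -(expected_next pi_plan Yy0).
under eq_bigr do rewrite step.
rewrite telescope_sumr// normrM ger0_norm ?invr_ge0// mulrC mulrA ler_wpM2r ?invr_ge0//.
by apply: le_trans (ler_normB _ _) _; rewrite mulr_natr mulr2n lerD.
Qed.

End plan.

Lemma finite_horizon_values T y0 : Y y0 -> exists2 pi, plans Y U pi &
  \sum_(0 <= t < T) \int[P]_w k (trajectory pi y0 t w).1 (trajectory pi y0 t w).2 =
    cost_to_go T y0 /\
  v P s Y U f k T y0 = T%:R^-1 * cost_to_go T y0.
Proof.
move=> Yy0.
have /choice[sel selP] : forall T, exists sg : 'rV[R]_n -> Uh, [/\ borel_fun Y sg,
    forall y, Y y -> U y (sg y) &
    forall y, Y y -> cost_to_go T.+1 y = objective 1 1 (cost_to_go T) (y, sg y)].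
  move=> t; have [sg [msg Usg bsg _]] :=
    @bellman_selector 1 1 _ ler01 (@ctg_lsc t) (ctg_bounded t).
  by exists sg.
(* At time [t] there are [T - t] steps to go, for which [sel (T - t.+1)] is optimal. From time [T]
   on truncated subtraction gives [sel 0], which is admissible, and those steps are not in the
   sum. *)
pose pi t := sel (T - t.+1)%N.
have pip : plans Y U pi by move=> t; have [? ? _] := selP (T - t.+1)%N.
have opt : \sum_(0 <= t < T) \int[P]_w k (trajectory pi y0 t w).1 (trajectory pi y0 t w).2 =
    cost_to_go T y0.
  have [_ ->] := finite_horizon_cost pip Yy0 T.
  rewrite big1 ?addr0// => t _.
  transitivity (\int[P]_(_ in setT) (0 : R)); last by rewrite Rintegral_cst// mul0r.
  apply: eq_Rintegral => w _; have [Yw _] := trajectory_graph pip Yy0 t w.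
  have [_ _ h] := selP (T - t.+1)%N.
  by rewrite /gap h// subrr.
exists pi => //; split=> //; rewrite /v; congr (_ * _); apply: minimumE.
  by exists pi => //; have [-> _] := finite_horizon_cost pip Yy0 T.
move=> _ [pi' pip' <-]; have [-> ->] := finite_horizon_cost pip' Yy0 T.
rewrite lerDl; apply: sumr_ge0 => t _; apply: Rintegral_ge0 => w _.
by apply: gap_ge0; exact: trajectory_graph.
Qed.

Lemma finite_horizon_dual T gam m : W_lim P s Y U f gam ->
  (forall y, Y y -> m <= cost_to_go T y) ->
  m <= T%:R * \int[gam]_(p in GB) k p.1 p.2.
Proof.
move=> gamW mT; have mG := graph_measurable; have [gam1 _] := gamW.
have bV t := graph_state_bmf (@ctg_lsc t) (ctg_bounded t).
have bN t := graph_next_bmf (@ctg_lsc t) (ctg_bounded t).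
have i1 := bmf_integrable gam mG cost_bmf.
(* Invariance under [W_lim] means that each Bellman step adds at most one integral of [k]. *)
have h t : \int[gam]_(p in GB) cost_to_go t p.1 <= t%:R * \int[gam]_(p in GB) k p.1 p.2.
  elim: t => [|t ih]; first by rewrite /= Rintegral_cst// !mul0r.
  apply: (@le_trans _ _ (\int[gam]_(p in GB) (k p.1 p.2 + next (cost_to_go t) p))).
    apply: le_Rintegral => //; first exact: (bmf_integrable gam mG (bV t.+1)).
      exact: (bmf_integrable gam mG (bmfD cost_bmf (bN t))).
    by move=> p Gp; have := gap_ge0 t Gp; rewrite subr_ge0 /objective !mul1r.
  rewrite RintegralD//; last exact: (bmf_integrable gam mG (bN t)).
  by rewrite (W_lim_next gamW)// -natr1 mulrDl mul1r addrC lerD2r.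
apply: le_trans (h T).
apply: (@le_trans _ _ (\int[gam]_(p in GB) m)).
  by rewrite Rintegral_cst// (congr1 fine gam1) mulr1.
apply: le_Rintegral => //.
- exact: (bmf_integrable gam mG (bmf_cst GB m)).
- exact: (bmf_integrable gam mG (bV T)).
- by move=> p [Yp _]; exact: mT.
Qed.

End finite_horizon.

(** * Limits *)

Section limit.

(* Any limit point of the gam_i lies in W_lim and has cost at most lim m_i,
   while m_i bounds the cost from below on W_lim: so the limit point is a
   minimizer, and in particular kstar is attained. *)
Let asymptotic_minimum_ultra (I : Type) (F : set_system I) (m r : I -> R)
    (gam : I -> probability (borel ('rV[R]_n * Uh)%type) R) :
  UltraFilter F -> r @ F --> (0 : R) -> (forall i, gam i GB = 1%E) ->
  (\forall i \near F, \int[gam i]_(p in GB) k p.1 p.2 = m i) ->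
  (\forall i \near F, forall phi (M : R), {within Y, continuous phi} ->
    (forall y, Y y -> `|phi y| <= M) ->
    `|\int[gam i]_(p in GB) (next phi p - phi p.1)| <= M * r i) ->
  (\forall i \near F, forall mu, W_lim P s Y U f mu ->
    m i <= \int[mu]_(p in GB) k p.1 p.2) ->
  m @ F --> kstar P s Y U f k.
Proof.
move=> uF r0 gam1 gamk gamW gamd.
have pF : ProperFilter F by exact: ultra_proper.
have mG := graph_measurable.
have [mu [mu1 muI]] := weak_compactness uF graph_closed graph_compact gam1.
(* The one-sided bound of [weak_compactness], applied to [g] and to its opposite, gives equality for
   continuous [g]. *)
have mu_int g l : seq_continuous_on G g -> bounded_on G g ->
    \int[gam i]_(p in GB) g p @[i --> F] --> l -> \int[mu]_(p in GB) g p = l.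
  move=> cg [M gM] gl.
  have lg : lsc_on G g by apply: seq_continuous_lsc_on => //; exact: graph_closed.
  have cNg : seq_continuous_on G (fun p => -1 * g p) by exact: seq_continuous_onZ.
  have lNg : lsc_on G (fun p => -1 * g p).
    by apply: seq_continuous_lsc_on => //; exact: graph_closed.
  have bg : bounded_on G g by exists M.
  have bg' : bmf GB g by exact: lsc_on_bmf.
  have bNg : bounded_on G (fun p => -1 * g p).
    by exists M => p Gp; rewrite mulN1r normrN gM.
  have h1 := muI _ _ lg bg gl.
  have h2 : \int[mu]_(p in GB) (-1 * g p) <= -1 * l.
    apply: muI => //.
    have e i : \int[gam i]_(p in GB) (-1 * g p) = -1 * \int[gam i]_(p in GB) g p.
      by rewrite RintegralZl//; exact: bmf_integrable.
    by under eq_fun do rewrite e; exact: cvgMl_tmp.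
  move: h2; rewrite RintegralZl//; last exact: bmf_integrable.
  by rewrite !mulN1r lerN2 => h2; apply/eqP; rewrite eq_le h1.
have muW : W_lim P s Y U f mu.
  split => // phi cphi.
  have lphi := within_lsc_on Y_closed cphi.
  have [M phiM] := within_bounded_on Y_compact Y_closed cphi.
  apply: mu_int.
  - have c1 := @seq_continuous_next phi cphi.
    have c2 := @seq_continuous_onZ _ _ G (-1) _ (@seq_continuous_state phi cphi).
    have := seq_continuous_onD c1 c2.
    by under eq_fun do rewrite mulN1r.
  - exists (M + M) => p Gp; apply: le_trans (ler_normB _ _) _; apply: lerD.
      exact: next_bounded.
    by apply: phiM; case: Gp.
  - apply/norm_cvg0P; apply: (@squeeze_cvgr _ _ _ _ (fun=> 0) (fun i => M * r i)).
    + apply: filterS gamW => i h.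
      by rewrite normr_ge0 /=; exact: h.
    + exact: cvg_cst.
    + by rewrite -(mulr0 M); exact: cvgMl_tmp.
have [Mk Mk0 kM] := cost_bounded.
have [l _ il] : exists2 l : R, `[- Mk, Mk]%classic l &
    \int[gam i]_(p in GB) k p.1 p.2 @[i --> F] --> l.
  apply: (@ultra_cvg_compact R I F (fun i => \int[gam i]_(p in GB) k p.1 p.2)
    `[- Mk, Mk]%classic) => //; first exact: segment_compact.
  move=> i; rewrite /= in_itv/= -ler_norml.
  by apply: (Rintegral_norm_le (mu := gam i) mG (gam1 i) cost_bmf).
have mukl : \int[mu]_(p in GB) k p.1 p.2 = l.
  by apply: mu_int => //; [exact: seq_continuous_cost|exists Mk].
have ml : m @ F --> l.
  by apply: cvg_trans il; apply: near_eq_cvg.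
suff -> : kstar P s Y U f k = l by [].
apply: minimumE; first by exists mu.
move=> _ [nu nuW <-].
by apply: cvg_ler_near ml (cvg_cst _) _; apply: filterS gamd => i; exact.
Qed.

(** If the preimage of a neighborhood of [kstar] were not in [F], then [F] restricted to its
    complement would be proper, and an ultrafilter refining this restriction would contradict the
    ultrafilter case. *)
Lemma asymptotic_minimum (I : Type) (F : set_system I) (m r : I -> R) :
  ProperFilter F -> r @ F --> (0 : R) ->
  (\forall i \near F, exists gam : probability (borel ('rV[R]_n * Uh)%type) R,
    [/\ gam GB = 1%E, \int[gam]_(p in GB) k p.1 p.2 = m i &
     forall phi (M : R), {within Y, continuous phi} -> (forall y, Y y -> `|phi y| <= M) ->
       `|\int[gam]_(p in GB) (next phi p - phi p.1)| <= M * r i]) ->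
  (\forall i \near F, forall mu, W_lim P s Y U f mu ->
    m i <= \int[mu]_(p in GB) k p.1 p.2) ->
  m @ F --> kstar P s Y U f k.
Proof.
move=> pF r0 gamP gamd.
(* A default for the indices without a suitable measure, since every index has to carry a
   probability on the graph. *)
have [i0 [gam0 [gam01 _ _]]] := filter_ex gamP.
pose Q i (gam : probability (borel ('rV[R]_n * Uh)%type) R) :=
  [/\ gam GB = 1%E, \int[gam]_(p in GB) k p.1 p.2 = m i &
     forall phi (M : R), {within Y, continuous phi} -> (forall y, Y y -> `|phi y| <= M) ->
       `|\int[gam]_(p in GB) (next phi p - phi p.1)| <= M * r i].
have /choice[gam gamQ] : forall i, exists gam : probability (borel ('rV[R]_n * Uh)%type) R,
    gam GB = 1%E /\ ((exists g, Q i g) -> Q i gam).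
  move=> i; have [[g Qg]|nQ] := pselect (exists g, Q i g).
    by exists g; split => //; case: Qg.
  by exists gam0; split.
have nearQ : \forall i \near F, Q i (gam i).
  by apply: filterS gamP => i Qi; exact: (gamQ i).2.
move=> A Ak; apply: contrapT => nA.
pose D := ~` (m @^-1` A).
have pD : ProperFilter (within D F).
  apply: Build_ProperFilter => h; apply: nA.
  have h' : F [set i : I | D i -> False] := h.
  change (F (m @^-1` A)); apply: filterS h' => i /= nD.
  by have [//|mA] := pselect ((m @^-1` A) i); case: (nD mA).
have [w [uw Fw]] := ultraFilterLemma pD.
have sub B : F B -> w B by move=> FB; apply: Fw; exact: (@cvg_within _ F _ D _ FB).
have pw : ProperFilter w by exact: ultra_proper.
have wD : w D by apply: Fw; exact: withinT.
suff : m @ w --> kstar P s Y U f k.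
  move=> /(_ _ Ak) wA; have : w (D `&` m @^-1` A) by exact: filterI.
  by move=> /filter_ex[i []].
apply: (@asymptotic_minimum_ultra I w m r gam uw).
- by move=> B /r0/sub.
- by move=> i; exact: (gamQ i).1.
- by apply: sub; apply: filterS nearQ => i [].
- by apply: sub; apply: filterS nearQ => i [].
- exact: sub.
Qed.

Lemma discounted_limit :
  minimum [set h P s Y U f k eps y0 | y0 in Y] @[eps --> 0^'+] --> kstar P s Y U f k.
Proof.
have mG := graph_measurable.
have val eps : 0 < eps < 1 -> exists V y1, [/\ lsc_on Y V /\ bounded_on Y V,
    forall y, Y y -> V y = bellman eps (1 - eps) V y,
    Y y1, forall y, Y y -> V y1 <= V y &
    minimum [set h P s Y U f k eps y0 | y0 in Y] = V y1].
  move=> eps01; have [V [lV bV fixV]] := bellman_fixpoint eps01.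
  have [y1 Yy1 y1min] := lsc_on_min Y_compact Y_nonempty lV.
  exists V, y1; split => //.
  have hV y : Y y -> h P s Y U f k eps y = V y.
    by move=> Yy; have [gam [_ _ -> _]] := discounted_values eps01 lV bV fixV Yy.
  apply: minimumE; first by exists y1 => //; exact: hV.
  by move=> _ [y Yy <-]; rewrite hV// y1min.
(* The drift is the balance, which integrates to 0, plus [eps] times a difference of two terms
   bounded by [M]: hence the rate [eps * 2]. *)
apply: (@asymptotic_minimum R (0^'+) _ (fun eps => eps * 2)).
- by rewrite -[X in _ --> X](mul0r 2); apply: cvgMr_tmp; exact: cvg_at_right_filter.
- near=> eps; have eps01 : 0 < eps < 1.
    by apply/andP; split; near: eps; [exact: nbhs_right_gt|exact: nbhs_right_lt].
  have [V [y1 [[lV bV] fixV Yy1 y1min ->]]] := val eps eps01.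
  have [gam [gamW gamk _ _]] := discounted_values eps01 lV bV fixV Yy1.
  have [gam1 gam0] := gamW; exists gam; split => // phi M cphi phiM.
  have lphi := within_lsc_on Y_closed cphi.
  have bphi : bounded_on Y phi by exists M.
  have b1 := balance_bmf eps y1 lphi bphi.
  have b2 : bmf GB (fun p => next phi p - phi y1).
    by apply: bmfB; [exact: graph_next_bmf|exact: bmf_cst].
  rewrite (_ : \int[gam]_(p in GB) (next phi p - phi p.1) =
      \int[gam]_(p in GB) (balance eps y1 phi p + eps * (next phi p - phi y1))); last first.
    by apply: eq_Rintegral => p _; rewrite /balance; ring.
  rewrite RintegralD//; [|exact: (bmf_integrable gam mG b1)|
    exact: (bmf_integrable gam mG (bmfZ eps b2))].
  rewrite (W_disc_balance Yy1 gamW)// add0r RintegralZl//; last first.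
    exact: (bmf_integrable gam mG b2).
  have [e0 _] := andP eps01.
  rewrite normrM gtr0_norm// mulrCA ler_pM2l// mulr_natr mulr2n.
  apply: (Rintegral_norm_le (mu := gam) mG gam1 b2) => p Gp.
  by apply: le_trans (ler_normB _ _) _; apply: lerD; [exact: next_bounded|exact: phiM].
- near=> eps; have eps01 : 0 < eps < 1.
    by apply/andP; split; near: eps; [exact: nbhs_right_gt|exact: nbhs_right_lt].
  have [V [y1 [[lV bV] fixV Yy1 y1min ->]]] := val eps eps01.
  by move=> mu muW; exact: (discounted_lim_dual eps01 lV bV fixV muW).
Unshelve. all: by end_near. Qed.

Lemma finite_horizon_limit :
  minimum [set v P s Y U f k T y0 | y0 in Y] @[T --> \oo] --> kstar P s Y U f k.
Proof.
have val T : exists y1, [/\ Y y1, forall y, Y y -> cost_to_go T y1 <= cost_to_go T y &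
    minimum [set v P s Y U f k T y0 | y0 in Y] = T%:R^-1 * cost_to_go T y1].
  have [lT bT] := cost_to_go_lsc_bounded T.
  have [y1 Yy1 y1min] := lsc_on_min Y_compact Y_nonempty lT.
  have vT y : Y y -> v P s Y U f k T y = T%:R^-1 * cost_to_go T y.
    by move=> Yy; have [pi _ [_ ->]] := finite_horizon_values T Yy.
  exists y1; split => //; apply: minimumE; first by exists y1 => //; exact: vT.
  by move=> _ [y Yy <-]; rewrite vT// ler_wpM2l ?invr_ge0// y1min.
apply: (@asymptotic_minimum nat \oo _ (fun T => 2 / T%:R)).
- rewrite -[X in _ --> X](mulr0 2); apply: cvgMl_tmp.
  rewrite -(cvg_shiftS (fun T : nat => (T%:R : R)^-1)); exact: cvg_harmonic.
- near=> T; have T0 : (0 < T)%N by near: T; exact: nbhs_infty_gt.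
  have [y1 [Yy1 y1min ->]] := val T.
  have [pi pip [opt _]] := finite_horizon_values T Yy1.
  have [gam [gam1 gamI]] := average_occupation pip Yy1 T0.
  exists gam; split => //; first by rewrite gamI; [rewrite opt|exact: cost_bmf].
  by move=> phi M; exact: (average_occupation_drift pip Yy1 T0 gamI).
- near=> T; have T0 : (0 < T)%N by near: T; exact: nbhs_infty_gt.
  have [y1 [Yy1 y1min ->]] := val T.
  move=> mu muW; rewrite ler_pdivrMl ?ltr0n//.
  exact: finite_horizon_dual.
Unshelve. all: by end_near. Qed.

End limit.

End system.

Theorem corollary3p3 (R : realType) (n : nat) (Uh : pmetricType R)
    (S : ptopologicalType) (d : measure_display) (Omega : measurableType d)
    (P : probability Omega R) (s : nat -> Omega -> S)
    (Y : set 'rV[R]_n) (U : 'rV[R]_n -> set Uh)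
    (f : 'rV[R]_n -> Uh -> S -> 'rV[R]_n) (k : 'rV[R]_n -> Uh -> R)
    (Y_nonempty : Y !=set0) (Y_compact : compact Y)
    (Uh_compact : compact [set: Uh])
    (S_polish : polish R S)
    (f_bounded : exists M : R, forall y u z, Y y -> `|f y u z| <= M)
    (f_continuous : forall z,
      {within Y `*` [set: Uh], continuous (fun p => f p.1 p.2 z)})
    (f_measurable : forall y u, Y y -> borel_fun [set: S] (f y u))
    (s_iid : iid P s)
    (U_usc : upper_semicontinuous_on Y U)
    (U_nonempty : forall y, Y y -> U y !=set0)
    (U_compact : forall y, Y y -> compact (U y))
    (f_invariant : forall y u z, Y y -> U y u -> Y (f y u z))
    (k_continuous :
      {within Y `*` [set: Uh], continuous (fun p => k p.1 p.2)}) :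
  [/\ (forall (y0 : 'rV[R]_n) (eps : R), Y y0 -> 0 < eps < 1 ->
        h P s Y U f k eps y0 = kstar_disc P s Y U f k eps y0),
      minimum [set h P s Y U f k eps y0 | y0 in Y] @[eps --> 0^'+]
        --> kstar P s Y U f k &
      minimum [set v P s Y U f k T y0 | y0 in Y] @[T --> \oo]
        --> kstar P s Y U f k].
Proof.
split.
- move=> y0 eps Yy0 eps01.
  have [V [lV bV fixV]] := bellman_fixpoint Y_nonempty Y_compact Uh_compact
    f_continuous f_measurable s_iid U_usc U_nonempty U_compact f_invariant
    k_continuous eps01.
  have [gam [_ _ -> ->]] := discounted_values Y_nonempty Y_compact Uh_compact
    f_continuous f_measurable s_iid U_usc U_nonempty U_compact f_invariant
    k_continuous eps01 lV bV fixV Yy0.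
  by [].
- exact: discounted_limit.
- exact: finite_horizon_limit.
Qed.
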